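(* Let $\gamma$ be an even positive integer, $\alpha\in\mathbb{R}$, $-\frac{m}{\gamma}<t<\frac{m}{\gamma}$, and assume $Q+\alpha-2>0$. Then there is a constant $C>0$, independent of $\phi$ and of $r$, such that for every $r>0$ and every $\phi\in C_0^\infty(B_r)$, $$\int_{B_r}\rho^{\alpha}|\nabla_\gamma\rho|^t|\nabla_\gamma\phi|^2\,dz\ \ge\ \Big(\frac{Q+\alpha-2}{2}\Big)^2\int_{B_r}\rho^{\alpha}\frac{|\nabla_\gamma\rho|^{t+2}}{\rho^2}\phi^2\,dz+\frac{1}{C^2r^2}\int_{B_r}\rho^{\alpha}|\nabla_\gamma\rho|^t\phi^2\,dz .$$
   Context: Points of $\mathbb{R}^n$ are written $z=(x,y)$ with $x\in\mathbb{R}^m$, $y\in\mathbb{R}^k$, $m,k\ge1$, $n=m+k$, and $\gamma>0$. The Baouendi–Grushin gradient is $\nabla_\gamma=(\partial_{x_1},\dots,\partial_{x_m},|x|^\gamma\partial_{y_1},\dots,|x|^\gamma\partial_{y_k})$, and the Baouendi–Grushin operator is $\Delta_\gamma=\nabla_\gamma\cdot\nabla_\gamma=\Delta_x+|x|^{2\gamma}\Delta_y$. The homogeneous dimension is $Q=m+(1+\gamma)k$. The gauge is $\rho(z)=\big(|x|^{2(1+\gamma)}+(1+\gamma)^2|y|^2\big)^{\frac{1}{2(1+\gamma)}}$; one has $|\nabla_\gamma\rho|=|x|^\gamma/\rho^\gamma$. For $r>0$, $B_r=\{z\in\mathbb{R}^n:\rho(z)<r\}$. The integral on the left-hand side is allowed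 to be $+\infty$. *)

(* Defs.v *)
From HB Require Import structures.
From mathcomp Require Import all_boot all_order all_algebra.
From mathcomp Require Import all_classical all_reals all_analysis.
Set Implicit Arguments. Unset Strict Implicit. Unset Printing Implicit Defensive.
Import Order.TTheory GRing.Theory Num.Theory.
Import numFieldNormedType.Exports.
Local Open Scope classical_set_scope.
Local Open Scope ring_scope.

Definition consrow (R : realType) (n : nat) (t : R) (v : 'rV[R]_n) : 'rV[R]_n.+1 :=
  \row_(i < n.+1) match unlift ord0 i with Some j => v ord0 j | None => t end.

(* Lebesgue integral over R^n of a function with values in \bar R, realized
   as the iterated one-dimensional Lebesgue integral (Tonelli: for
   nonnegative measurable integrands this is the n-dimensional Lebesgue
   integral). *)
Fixpoint lebint (R : realType) (n : nat) : ('rV[R]_n -> \bar R) -> \bar R :=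
  match n return ('rV[R]_n -> \bar R) -> \bar R with
  | 0 => fun f => f 0
  | n'.+1 => fun f =>
      (\int[@lebesgue_measure R]_t lebint (fun v => f (consrow t v)))%E
  end.

Definition enorm (R : realType) (n : nat) (v : 'rV[R]_n) : R :=
  Num.sqrt (\sum_(i < n) v ord0 i ^+ 2).

Definition xpart (R : realType) (m k : nat) (z : 'rV[R]_(m + k)) : 'rV[R]_m :=
  lsubmx z.
Definition ypart (R : realType) (m k : nat) (z : 'rV[R]_(m + k)) : 'rV[R]_k :=
  rsubmx z.

Definition ex (R : realType) (m k : nat) (i : 'I_m) : 'rV[R]_(m + k) :=
  delta_mx ord0 (lshift k i).
Definition ey (R : realType) (m k : nat) (j : 'I_k) : 'rV[R]_(m + k) :=
  delta_mx ord0 (rshift m j).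

Definition gradG2 (R : realType) (m k gamma : nat) (f : 'rV[R]_(m + k) -> R)
    (z : 'rV[R]_(m + k)) : R :=
  \sum_(i < m) (derive f z (@ex R m k i)) ^+ 2
  + enorm (xpart z) ^+ (2 * gamma) * \sum_(j < k) (derive f z (@ey R m k j)) ^+ 2.

Definition gradGnorm (R : realType) (m k gamma : nat) (f : 'rV[R]_(m + k) -> R)
    (z : 'rV[R]_(m + k)) : R :=
  Num.sqrt (gradG2 gamma f z).

Definition rho (R : realType) (m k gamma : nat) (z : 'rV[R]_(m + k)) : R :=
  powR (enorm (xpart z) ^+ (2 * gamma.+1)
        + (gamma.+1)%:R ^+ 2 * enorm (ypart z) ^+ 2)
       (2 * (gamma.+1)%:R)^-1.

Definition gball (R : realType) (m k gamma : nat) (r : R) : set 'rV[R]_(m + k) :=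
  [set z | rho gamma z < r].

Fixpoint Cj (R : realType) (n : nat) (j : nat) (f : 'rV[R]_n -> R) : Prop :=
  match j with
  | 0 => continuous f
  | j'.+1 => (forall z, differentiable f z) /\ forall v, Cj j' (fun z => derive f z v)
  end.

Definition smooth (R : realType) (n : nat) (f : 'rV[R]_n -> R) : Prop :=
  forall j, Cj j f.

Definition Cc_infty (R : realType) (n : nat) (U : set 'rV[R]_n)
    (f : 'rV[R]_n -> R) : Prop :=
  [/\ smooth f,
      compact (closure [set z | f z != 0]) &
      closure [set z | f z != 0] `<=` U].

(* Main.v *)
(* For a vector field F and a weight w, expanding |grad phi + phi F|^2 >= 0 and integrating by parts gives
     int w |grad phi|^2 >= int (div (w F) - w |F|^2) phi^2.
   With w = rho^alpha |grad rho|^t and c = (Q + alpha - 2) / 2, the field F = c grad rho / rho yields exactly the sharp Hardy term. The remainder comes from adding mu (x + M rho grad rho), mu = delta / r^2: up to a term of size |grad rho|^2, its weighted divergence is mu (m + gamma t) > 0, where x controls the region in which grad rho degenerates, rho grad rho absorbs the error for M large, and the quadratic error is of order delta^2 / r^2, hence negligible for small delta.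
   The singularities on {x = 0} are avoided by multiplying F with a cutoff in |x| that increases with |x|. As F points away from {x = 0}, the derivative of the cutoff contributes with the good sign, and monotone convergence removes the cutoff. *)

Require Import Defs.
From HB Require Import structures.
From mathcomp Require Import all_boot all_order all_algebra.
From mathcomp Require Import all_classical all_reals all_analysis measurable_realfun.
From mathcomp Require Import ring lra.
Import Order.TTheory GRing.Theory Num.Theory.
Import numFieldNormedType.Exports.
Local Open Scope classical_set_scope.
Local Open Scope ring_scope.
Set Implicit Arguments. Unset Strict Implicit. Unset Printing Implicit Defensive.

(** The weighted Grushin divergence is the Euclidean divergence of a flux whose y components carry
    an extra factor |x|^gamma. For the fields used here, the j-th component of that flux is z_j
    times a function of p = |x|^2 and q = |y|^2. The divergence, the energy w |F|^2 and the
    remainder estimate thus become algebra in p, q, P = |x|^(2 gamma) and E = rho^(2(1+gamma)) = p P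
    + (1+gamma)^2 q. The integrals are iterated, with values in the extended reals, and may be
    infinite; they can be added and exchanged safely only for nonnegative jointly measurable
    integrands. Integration by parts is therefore applied only to a compactly supported flux G with
    continuous derivatives, in the form of a pointwise inequality A <= D + div G. A bounded function
    of compact support is added to both sides to make every term nonnegative, and is cancelled at
    the end because its integral is finite. The weight near {x = 0} and the energy may then have
    infinite integrals. *)

(** * Joint measurability and iterated integrals *)

(* Measurability of [f] for the product of the sigma-algebra of [S] and the Borel sigma-algebra of R^n, unfolded along the same recursion as [lebint]: the leading coordinate is moved into the parameter space, so that Tonelli's theorem applies one variable at a time. *)
Fixpoint jmeas (R : realType) (n : nat) d (S : measurableType d)
    d' (T : measurableType d') : (S -> 'rV[R]_n -> T) -> Prop :=
  match n return (S -> 'rV[R]_n -> T) -> Prop with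
  | 0 => fun f => measurable_fun setT (f ^~ 0)
  | n'.+1 => fun f =>
      @jmeas R n' _ (S * measurableTypeR R)%type _ T
        (fun (st : S * measurableTypeR R) v => f st.1 (consrow st.2 v))
  end.

Section jmeas.
Context (R : realType).

Lemma jmeas_comp n d (S : measurableType d) d1 (T1 : measurableType d1)
    d2 (T2 : measurableType d2) (g : T1 -> T2) (f : S -> 'rV[R]_n -> T1) :
  measurable_fun setT g -> jmeas f -> jmeas (fun s v => g (f s v)).
Proof.
elim: n d S f => [|n IH] d S f mg /=; first exact: measurableT_comp.
exact: IH.
Qed.

Lemma jmeas_pair n d (S : measurableType d) d1 (T1 : measurableType d1)
    d2 (T2 : measurableType d2) (f : S -> 'rV[R]_n -> T1) (g : S -> 'rV[R]_n -> T2) :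
  jmeas f -> jmeas g -> jmeas (fun s v => (f s v, g s v)).
Proof.
elim: n d S f g => [|n IH] d S f g /=; first by move=> ? ?; exact: measurable_fun_pair.
exact: IH.
Qed.

Lemma jmeas_precomp n d (S : measurableType d) d1 (S1 : measurableType d1)
    d2 (T : measurableType d2) (g : S1 -> S) (f : S -> 'rV[R]_n -> T) :
  measurable_fun setT g -> jmeas f -> jmeas (fun s v => f (g s) v).
Proof.
elim: n d S d1 S1 f g => [|n IH] d S d1 S1 f g mg /= mf.
  exact: (measurableT_comp mf mg).
apply: (IH _ (S * measurableTypeR R)%type _ (S1 * measurableTypeR R)%type
              (fun (st : S * measurableTypeR R) v => f st.1 (consrow st.2 v))
              (fun st : S1 * measurableTypeR R => (g st.1, st.2)) _ mf).
by apply: measurable_fun_pair => /=; [exact: (measurableT_comp mg)|exact: measurable_snd].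
Qed.

Lemma lebint_ge0 n (f : 'rV[R]_n -> \bar R) :
  (forall z, 0 <= f z)%E -> (0 <= lebint f)%E.
Proof.
elim: n f => [|n IH] f f0 /=; first exact: f0.
by apply: integral_ge0 => t _; apply: IH.
Qed.

Lemma measurable_lebint n d (S : measurableType d) (f : S -> 'rV[R]_n -> \bar R) :
  (forall s v, 0 <= f s v)%E -> jmeas f ->
  measurable_fun setT (fun s => lebint (f s)).
Proof.
elim: n d S f => [|n IH] d S f f0 //= mf.
have := IH _ (S * measurableTypeR R)%type _ (fun (st : S * measurableTypeR R) v => f0 st.1 (consrow st.2 v)) mf.
move/(@measurable_fun_fubini_tonelli_F _ _ _ _ _ (@lebesgue_measure R)).
apply => st; exact: lebint_ge0.
Qed.

Lemma measurable_lebint_head n d (S : measurableType d)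
    (f : S -> 'rV[R]_n.+1 -> \bar R) s :
  (forall s v, 0 <= f s v)%E -> jmeas f ->
  measurable_fun setT
    (fun t : measurableTypeR R => lebint (fun v => f s (consrow t v))).
Proof.
move=> f0 mf.
have := measurable_lebint (S := (S * measurableTypeR R)%type) (fun (st : S * measurableTypeR R) v => f0 st.1 (consrow st.2 v)) mf.
move=> h; exact: (measurableT_comp h (measurable_pair1 s)).
Qed.

Lemma lebintD n d (S : measurableType d) (f g : S -> 'rV[R]_n -> \bar R) s :
  (forall s v, 0 <= f s v)%E -> (forall s v, 0 <= g s v)%E ->
  jmeas f -> jmeas g ->
  (lebint (fun v => f s v + g s v) = lebint (f s) + lebint (g s))%E.
Proof.
elim: n d S f g s => [|n IH] d S f g s f0 g0 mf mg //=.
rewrite -ge0_integralD//; last 4 first.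
- by move=> t _; apply: lebint_ge0.
- exact: measurable_lebint_head.
- by move=> t _; apply: lebint_ge0.
- exact: measurable_lebint_head.
apply: eq_integral => t _.
exact: (IH _ (S * measurableTypeR R)%type (fun (st : S * measurableTypeR R) v => f st.1 (consrow st.2 v))
  (fun (st : S * measurableTypeR R) v => g st.1 (consrow st.2 v)) (s, t)).
Qed.

Lemma lebintZl n d (S : measurableType d) (f : S -> 'rV[R]_n -> \bar R) s (c : R) :
  (forall s v, 0 <= f s v)%E -> jmeas f -> 0 <= c ->
  (lebint (fun v => c%:E * f s v) = c%:E * lebint (f s))%E.
Proof.
elim: n d S f s => [|n IH] d S f s f0 mf c0 //=.
rewrite -ge0_integralZl_EFin//; last 2 first.
- by move=> t _; apply: lebint_ge0.
- exact: measurable_lebint_head.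
apply: eq_integral => t _.
exact: (IH _ (S * measurableTypeR R)%type (fun (st : S * measurableTypeR R) v => f st.1 (consrow st.2 v)) (s, t)).
Qed.

Lemma le_lebint n d (S : measurableType d) (f g : S -> 'rV[R]_n -> \bar R) s :
  (forall s v, 0 <= f s v)%E -> (forall s v, 0 <= g s v)%E ->
  jmeas f -> jmeas g -> (forall s v, f s v <= g s v)%E ->
  (lebint (f s) <= lebint (g s))%E.
Proof.
elim: n d S f g s => [|n IH] d S f g s f0 g0 mf mg fg //=.
apply: ge0_le_integral => //.
- by move=> t _; apply: lebint_ge0.
- exact: measurable_lebint_head.
- exact: measurable_lebint_head.
move=> t _.
exact: (IH _ (S * measurableTypeR R)%type (fun (st : S * measurableTypeR R) v => f st.1 (consrow st.2 v))
  (fun (st : S * measurableTypeR R) v => g st.1 (consrow st.2 v)) (s, t)).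
Qed.

(** The inner integrals again form a nondecreasing sequence of measurable functions, so the
    one-dimensional theorem applies at each level of the recursion. *)
Lemma cvg_monotone_lebint n d (S : measurableType d)
    (f : nat -> S -> 'rV[R]_n -> \bar R) (g : S -> 'rV[R]_n -> \bar R) s :
  (forall j s v, 0 <= f j s v)%E -> (forall j, jmeas (f j)) ->
  (forall s v, nondecreasing_seq (fun j => f j s v)) ->
  (forall s v, f ^~ s ^~ v @ \oo --> g s v) ->
  lebint (f j s) @[j --> \oo] --> lebint (g s).
Proof.
elim: n d S f g s => [|n IH] d S f g s f0 mf ndf fg /=; first exact: fg.
have IH' t := IH _ (S * measurableTypeR R)%type (fun j (st : S * measurableTypeR R) v => f j st.1 (consrow st.2 v))
  (fun (st : S * measurableTypeR R) v => g st.1 (consrow st.2 v)) (s, t)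
  (fun j st v => f0 j st.1 (consrow st.2 v)) mf
  (fun st v => ndf st.1 (consrow st.2 v)) (fun st v => fg st.1 (consrow st.2 v)).
rewrite (_ : (\int[_]_t _)%E = (\int[@lebesgue_measure R]_t
   limn (fun j => lebint (fun v => f j s (consrow t v))))%E); last first.
  by apply: eq_integral => t _; apply/esym/cvg_lim => //; exact: IH'.
apply: cvg_monotone_convergence => //.
- by move=> j; exact: measurable_lebint_head.
- by move=> j t _; apply: lebint_ge0.
- move=> t _ i j ij.
  apply: (@le_lebint _ _ (S * measurableTypeR R)%type
    (fun (st : S * measurableTypeR R) v => f i st.1 (consrow st.2 v))
    (fun st v => f j st.1 (consrow st.2 v)) (s, t)).
  + by move=> ? ?; exact: f0.
  + by move=> ? ?; exact: f0.
  + exact: mf.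
  + exact: mf.
  + by move=> ? ?; exact: ndf.
Qed.

(** Tonelli moves [t] past one coordinate at a time; the coordinate already passed joins the
    parameter space, where the induction hypothesis applies. *)
Lemma lebint_swap n d (S : measurableType d) (f : S -> R -> 'rV[R]_n -> \bar R) s :
  (forall s t v, 0 <= f s t v)%E ->
  jmeas (fun (st : S * measurableTypeR R) v => f st.1 st.2 v) ->
  (\int[@lebesgue_measure R]_t lebint (f s t) =
   lebint (fun v => \int[@lebesgue_measure R]_t f s t v))%E.
Proof.
elim: n d S f s => [|n IH] d S f s f0 mf //=.
pose swap (x : (S * measurableTypeR R) * measurableTypeR R) := ((x.1.1, x.2), x.1.2).
have mswap : measurable_fun setT swap.
  by do 2?apply: measurable_fun_pair => //; do ?exact: measurableT_comp.
pose f' (su : S * measurableTypeR R) t v := f su.1 t (consrow su.2 v).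
have mf' : jmeas (fun (st : (S * measurableTypeR R) * measurableTypeR R) v => f' st.1 st.2 v).
  exact: (jmeas_precomp mswap mf).
pose F (xy : measurableTypeR R * measurableTypeR R) :=
  lebint (fun v => f s xy.1 (consrow xy.2 v)).
have F0 xy : (0 <= F xy)%E by exact: lebint_ge0.
have mF : measurable_fun setT F.
  have := measurable_lebint (S := ((S * measurableTypeR R) * measurableTypeR R)%type)
    (f := fun st v => f st.1.1 st.1.2 (consrow st.2 v)) (fun st v => f0 _ _ _) mf.
  have mi : measurable_fun setT
      (fun xy : measurableTypeR R * measurableTypeR R => ((s, xy.1), xy.2)).
    by do 2?apply: measurable_fun_pair => //.
  by move=> h; exact: (measurableT_comp h mi).
transitivity (\int[@lebesgue_measure R]_u \int[@lebesgue_measure R]_t F (t, u))%E.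
  exact: (fubini_tonelli (m1 := @lebesgue_measure R) (m2 := @lebesgue_measure R) F).
apply: eq_integral => u _.
exact: (IH _ (S * measurableTypeR R)%type f' (s, u) (fun su t v => f0 _ _ _) mf').
Qed.

End jmeas.

Section consrow.
Context (R : realType) (n : nat).
Implicit Types (t : R) (v : 'rV[R]_n).

Lemma consrow0 t v : consrow t v ord0 ord0 = t.
Proof. by rewrite mxE unlift_none. Qed.

Lemma consrowS t v j : consrow t v ord0 (lift ord0 j) = v ord0 j.
Proof. by rewrite mxE liftK. Qed.

Lemma consrowDl h t v :
  consrow (h + t) v = h *: delta_mx ord0 ord0 + consrow t v.
Proof.
apply/rowP => i; case: (unliftP ord0 i) => [j|] ->.
  by rewrite !mxE !liftK /= mulr0 add0r.
by rewrite !mxE !unlift_none /= mulr1.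
Qed.

Lemma consrowDr h t v j :
  consrow t (h *: delta_mx ord0 j + v) =
  h *: delta_mx ord0 (lift ord0 j) + consrow t v.
Proof.
apply/rowP => i; case: (unliftP ord0 i) => [k|] ->.
  by rewrite !mxE !liftK !mxE /= (inj_eq lift_inj).
by rewrite !mxE !unlift_none /= mulr0 add0r.
Qed.

Lemma continuous_consrowl v : continuous (fun t => consrow t v).
Proof.
move=> /= t A /nbhs_ballP[e e0 eA].
apply/nbhs_ballP; exists e => //= u tu; apply: eA; split => // i j.
rewrite (ord1 i) {i}; case: (unliftP ord0 j) => [k|] ->.
  by rewrite !consrowS; exact: ballxx.
by rewrite !consrow0.
Qed.

Lemma continuous_consrowr t : continuous (consrow t : 'rV[R]_n -> _).
Proof.
move=> /= v A /nbhs_ballP[e e0 eA].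
apply/nbhs_ballP; exists e => //= u [_ vu]; apply: eA; split => // i j.
rewrite (ord1 i) {i}; case: (unliftP ord0 j) => [k|] ->.
  by rewrite !consrowS; exact: vu.
by rewrite !consrow0; exact: ballxx.
Qed.

Lemma normr_coord v j : `|v ord0 j| <= `|v|.
Proof.
by rewrite -[leRHS]/(mx_norm v) mx_normrE (le_bigmax _ (fun ij => `|v ij.1 ij.2|) (ord0, j)).
Qed.

End consrow.

Lemma normr_consrow (R : realType) n (t : R) (v : 'rV[R]_n) :
  `|t| <= `|consrow t v| /\ `|v| <= `|consrow t v|.
Proof.
split; first by rewrite -[X in `|X| <= _](consrow0 t v) normr_coord.
rewrite -[leLHS]/(mx_norm v) mx_normrE; apply: bigmax_le => //= -[i j] _ /=.
by rewrite (ord1 i) -(consrowS t v j) normr_coord.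
Qed.

Section caratheodory.
Context (R : realType).

(* [H s t] is the limit of its values at the points [floor (N t) / N], a countable gluing of measurable functions. *)
Lemma measurable_fun_caratheodory d (S : measurableType d) (H : S -> R -> R) :
  (forall t, measurable_fun setT (H ^~ t)) -> (forall s, continuous (H s)) ->
  measurable_fun setT (fun st : S * measurableTypeR R => H st.1 st.2).
Proof.
move=> mH cH.
pose a (N : nat) (t : R) : R := (Num.floor (t * N.+1%:R))%:~R / N.+1%:R.
apply: (@measurable_fun_cvg _ _ _ _ (fun N st => H st.1 (a N st.2))) => [N|[s t] _ /=]; last first.
  apply: (@cvg_comp _ _ _ (fun N => a N t) (H s)); last exact: cH.
  apply/cvgrPdist_le => /= e e0; near=> N.
  have N0 : 0 < N.+1%:R :> R by [].
  have /andP[h1 h2] := floor_itv (t * N.+1%:R).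
  have h3 : N.+1%:R^-1 <= e.
    by apply: ltW; near: N; exact: (near_infty_natSinv_lt (PosNum e0)).
  apply: le_trans h3.
  have -> : t - a N t = (t * N.+1%:R - (Num.floor (t * N.+1%:R))%:~R) / N.+1%:R.
    by rewrite mulrBl (mulfK (lt0r_neq0 N0)).
  rewrite normrM [X in _ * X]ger0_norm ?invr_ge0// ler_piMl ?invr_ge0//.
  rewrite ger0_norm ?subr_ge0// lerBlDr addrC.
  by move: h2; rewrite intrD => /ltW.
(* The strips on which the rounded point is constant are numbered through [pickle], so that their
   union runs over nat. *)
pose E i := [set st : S * measurableTypeR R | choice.pickle (Num.floor (st.2 * N.+1%:R)) = i].
have mE i : measurable (E i).
  have [[st0 E0]|nE] := pselect (exists st, E i st); last first.
    by rewrite (_ : E i = set0)//; apply/seteqP; split => // x xE; apply: nE; exists x.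
  pose z := Num.floor (st0.2 * N.+1%:R).
  rewrite (_ : E i = setT `*` ([set` `[z%:~R / N.+1%:R, (z + 1)%:~R / N.+1%:R[] : set (measurableTypeR R))).
    by apply: measurableX => //; exact: measurable_itv.
  apply/seteqP; split => -[s t] /=.
    move=> h; split=> //; rewrite in_itv/=.
    rewrite ler_pdivrMr// ltr_pdivlMr//.
    have -> : z = Num.floor (t * N.+1%:R).
      by apply: (pcan_inj choice.pickleK); rewrite /z E0 h.
    exact: floor_itv.
  move=> [_]; rewrite in_itv/= ler_pdivrMr// ltr_pdivlMr// => h.
  by rewrite /E/= (floor_def h) -E0.
rewrite (_ : setT = \bigcup_i E i); last first.
  by apply/seteqP; split => // st _; exists (choice.pickle (Num.floor (st.2 * N.+1%:R))).
apply/measurable_fun_bigcup => // i.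
have [[st0 E0]|nE] := pselect (exists st, E i st); last first.
  rewrite (_ : E i = set0); first exact: measurable_fun_set0.
  by apply/seteqP; split => // x xE; apply: nE; exists x.
apply: (@eq_measurable_fun _ _ _ _ _ (fun st => H st.1 (a N st0.2))).
  move=> st; rewrite inE => Est; rewrite /a.
  suff -> : Num.floor (st0.2 * N.+1%:R) = Num.floor (st.2 * N.+1%:R) by [].
  by apply: (pcan_inj choice.pickleK); rewrite E0 Est.
apply: measurable_funTS.
exact: (measurableT_comp (mH _) measurable_fst).
Unshelve. all: by end_near. Qed.

Lemma jmeas_caratheodory n d (S : measurableType d) (F : S -> 'rV[R]_n -> R) :
  (forall v, measurable_fun setT (F ^~ v)) -> (forall s, continuous (F s)) ->
  jmeas F.
Proof.
elim: n d S F => [|n IH] d S F mF cF /=; first exact: mF.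
apply: (IH _ (S * measurableTypeR R)%type
  (fun (st : S * measurableTypeR R) v => F st.1 (consrow st.2 v))).
  move=> v; apply: (measurable_fun_caratheodory (H := fun s t => F s (consrow t v))) => // s.
  by move=> t; apply: continuous_comp; [exact: continuous_consrowl|exact: cF].
move=> st v.
by apply: continuous_comp; [exact: continuous_consrowr|exact: cF].
Qed.

Lemma jmeas_continuous n d (S : measurableType d) (f : 'rV[R]_n -> R) :
  continuous f -> jmeas (fun _ : S => f).
Proof. by move=> cf; apply: jmeas_caratheodory => // v; exact: measurable_cst. Qed.

End caratheodory.

(** * Integrals of derivatives of compactly supported functions *)

Section integral_derivative.
Context (R : realType).
Local Notation mu := (@lebesgue_measure R).

Lemma is_derive_near0 (V : normedModType R) (f : V -> R) x v (df : R) :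
  is_derive x v f df -> (\near x, f x = 0) -> df = 0.
Proof.
move=> fdf f0.
have d0 : is_derive x v f 0.
  by apply: (near_eq_is_derive (f := cst 0)); apply: filterS f0 => u ->.
by rewrite -(@derive_val _ _ _ _ _ _ _ fdf) (@derive_val _ _ _ _ _ _ _ d0).
Qed.

(* The dominating [B] keeps every integrand nonnegative, so that iterated integrals can be manipulated without integrability conditions. *)
Lemma integral_addl_derivative (g g' B : R -> R) (L : R) :
  (forall t : R, is_derive t (1 : R) g (g' t)) -> continuous g' -> 0 < L ->
  (forall t, L <= `|t| -> g t = 0) ->
  measurable_fun (setT : set (measurableTypeR R)) B -> (forall t, `|g' t| <= B t) ->
  (\int[mu]_t (g' t + B t)%:E = \int[mu]_t (B t)%:E)%E.
Proof.
move=> dg cg' L0 g0 mB gB.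
have LL : - L < L by rewrite gt0_cp.
have g'0 t : L < `|t| -> g' t = 0.
  move=> Lt; apply: (is_derive_near0 (dg t)).
  by near=> u; apply: g0; apply: ltW; near: u; exact: (cvgr_gt _ (cvg_norm cvg_id) _ Lt).
pose f := EFin \o g'.
have fE : f = f \_ `[- L, L]%classic.
  apply/funext => t; rewrite patchE; case: ifPn => //.
  rewrite notin_setE/= in_itv/= => /negP; rewrite -ler_norml -ltNge => /g'0.
  by rewrite /f/= => ->.
have iLL : mu.-integrable `[- L, L]%classic f.
  apply: continuous_compact_integrable; first exact: segment_compact.
  exact: continuous_subspaceT.
have if_ : mu.-integrable setT f.
  by rewrite fE; exact: (proj1 (@integrable_mkcond _ _ _ mu _ f (measurable_itv `[- L, L])) iLL).
have int0 : (\int[mu]_t f t = 0)%E.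
  rewrite [in LHS]fE -integral_mkcond.
  have cg : continuous g.
    move=> t; apply: differentiable_continuous; apply/derivable1_diffP.
    exact: (@ex_derive _ _ _ _ _ _ _ (dg t)).
  rewrite (@continuous_FTC2 _ g' g)//.
  - have nL : L <= `|L| by rewrite ger0_norm// ltW.
    by rewrite !g0 ?normrN// subee.
  - exact: continuous_subspaceT.
  - split => //.
    + by apply: cvg_at_right_filter; exact: cg.
    + by apply: cvg_at_left_filter; exact: cg.
  - by move=> t _; rewrite derive1E; exact: (@derive_val _ _ _ _ _ _ _ (dg t)).
have mf : measurable_fun setT f by exact: measurable_int if_.
have ipos : (\int[mu]_t f^\+ t \is a fin_num)%E.
  exact: (integrable_fin_num measurableT (integrable_funepos measurableT if_)).
have ineg : (\int[mu]_t f^\- t \is a fin_num)%E.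
  exact: (integrable_fin_num measurableT (integrable_funeneg measurableT if_)).
have pE : (\int[mu]_t f^\+ t = \int[mu]_t f^\- t)%E.
  move: int0; rewrite integralE -(fineK ipos) -(fineK ineg) -EFinB => -[].
  by move/eqP; rewrite subr_eq0 => /eqP ->.
have mEB : measurable_fun (setT : set (measurableTypeR R)) (EFin \o B) by exact/measurable_EFinP.
have B0 t : 0 <= B t by exact: le_trans (gB t).
have gB0 t : 0 <= g' t + B t by have := gB t; rewrite ler_norml => /andP[]; lra.
(* Since f = f^+ - f^-, both sides integrate the same sum of nonnegative functions; the equal and
   finite integrals of f^+ and f^- then cancel. *)
have key : (\int[mu]_t (g' t + B t)%:E + \int[mu]_t f^\- t =
            \int[mu]_t (B t)%:E + \int[mu]_t f^\+ t)%E.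
  rewrite -!ge0_integralD//.
  - apply: eq_integral => t _; rewrite funeneg.unlock funepos.unlock /f /= -!EFin_max -!EFinD.
    by congr EFin; rewrite !maxEge; case: ifPn; case: ifPn; lra.
  - by move=> t _; rewrite lee_fin.
  - exact: measurable_funepos.
  - by move=> t _; rewrite lee_fin.
  - apply/measurable_EFinP; apply: (measurable_funD _ mB).
    exact/measurable_EFinP.
  - exact: measurable_funeneg.
by move: key; rewrite pE => /(congr1 (fun x => x - \int[mu]_t f^\- t)%E); rewrite !addeK.
Unshelve. all: by end_near. Qed.

End integral_derivative.

Section lebint_derivative.
Context (R : realType).

(** A directional derivative sees only one line, so it passes through any map that sends this line
    affinely to another. This serves for slices, for coordinates and for the chain rule. *)
Lemma is_derive_line (U V : normedModType R) (G : V -> R) (k : U -> V)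
    (x v : U) (w : V) (d : R) :
  (forall h : R, k (h *: v + x) = h *: w + k x) ->
  is_derive (k x) w G d -> is_derive x v (G \o k) d.
Proof.
move=> kE [dG Gd].
have E : (fun h : R => h^-1 *: (((G \o k) \o shift x) (h *: v) - (G \o k) x)) =
         (fun h : R => h^-1 *: ((G \o shift (k x)) (h *: w) - G (k x))).
  by apply/funext => h /=; rewrite kE.
by apply: DeriveDef; [rewrite /derivable E|rewrite /derive E].
Qed.

Lemma jmeas_section n d (S : measurableType d) d' (T : measurableType d')
    (f : S -> 'rV[R]_n -> T) v :
  jmeas f -> measurable_fun setT (f ^~ v).
Proof.
elim: n d S f v => [|n IH] d S f v mf; first by rewrite (thinmx0 v).
pose w : 'rV[R]_n := \row_j v ord0 (lift ord0 j).
have -> : v = consrow (v ord0 ord0) w.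
  apply/rowP => i; case: (unliftP ord0 i) => [j|] ->; last by rewrite consrow0.
  by rewrite consrowS mxE.
have mv : measurable_fun setT
    (fun s => (s, v ord0 ord0) : S * measurableTypeR R).
  by apply: measurable_fun_pair => //.
exact: (measurableT_comp (IH _ _ _ w mf) mv).
Qed.

(** If the differentiated coordinate is not the first, the first is frozen and induction applies.
    Otherwise [lebint_swap] makes it the innermost variable, where the one-dimensional lemma holds
    on every line. *)
Lemma lebint_addl_derivative n (i : 'I_n) (G G' B : 'rV[R]_n -> R) (L : R) :
  (forall z, is_derive z (delta_mx ord0 i : 'rV[R]_n) G (G' z)) -> continuous G' -> 0 < L ->
  (forall z, L <= `|z| -> G z = 0) ->
  jmeas (fun _ : unit => B) -> (forall z, `|G' z| <= B z) ->
  lebint (fun z => (G' z + B z)%:E) = lebint (fun z => (B z)%:E).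
Proof.
elim: n i G G' B => [[]//|n IH] i G G' B dG cG L0 G0 mB GB.
have B0 z : 0 <= B z by exact: le_trans (GB z).
have GB0 z : 0 <= G' z + B z by have := GB z; rewrite ler_norml => /andP[]; lra.
case: (unliftP ord0 i) dG => [j|] -> dG /=.
  apply: eq_integral => t _.
  apply: (IH j (fun v => G (consrow t v)) (fun v => G' (consrow t v))) => //.
  - move=> v; apply: (is_derive_line (k := consrow t)) (dG _) => h.
    exact: consrowDr.
  - by move=> v; apply: continuous_comp; [exact: continuous_consrowr|exact: cG].
  - by move=> v Lv; apply: G0; apply: (le_trans Lv); exact: (normr_consrow t v).2.
  - have mt : measurable_fun setT (fun u : unit => (u, t) : unit * measurableTypeR R).
      by apply: measurable_fun_pair => //.
    exact: (jmeas_precomp mt mB).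
have mE (f : 'rV[R]_n.+1 -> R) : jmeas (fun _ : unit => f) ->
    jmeas (fun _ : unit => EFin \o f).
  by apply: jmeas_comp; exact/measurable_EFinP.
have mG : jmeas (fun _ : unit => G') by exact: jmeas_continuous.
have mGB : jmeas (fun _ : unit => EFin \o (G' \+ B)).
  apply: mE.
  apply: (@jmeas_comp _ _ _ _ _ _ _ _ (fun x : R * R => x.1 + x.2)
    (fun (_ : unit) v => (G' v, B v))); last exact: jmeas_pair.
  by apply: measurable_funD; [exact: measurable_fst|exact: measurable_snd].
rewrite (lebint_swap (S := unit) (f := fun _ t v => (G' (consrow t v) + B (consrow t v))%:E) tt)//.
rewrite (lebint_swap (S := unit) (f := fun _ t v => (B (consrow t v))%:E) tt)//; last exact: mE.
congr lebint; apply/funext => v.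
apply: (integral_addl_derivative (g := fun t => G (consrow t v)) (g' := fun t => G' (consrow t v)) (L := L)) => //.
- move=> t; apply: (is_derive_line (k := fun t => consrow t v)) (dG _) => h.
  by rewrite [h *: _]mulr1 consrowDl.
- by move=> t; apply: continuous_comp; [exact: continuous_consrowl|exact: cG].
- by move=> t Lt; apply: G0; apply: (le_trans Lt); exact: (normr_consrow t v).1.
- have mt : measurable_fun setT (fun t : measurableTypeR R => (tt, t)).
    by apply: measurable_fun_pair => //.
  exact: (measurableT_comp (jmeas_section v mB) mt).
all: by move=> *; rewrite lee_fin.
Qed.

Lemma lebint0 n : lebint (fun _ : 'rV[R]_n => 0%:E) = 0%:E.
Proof.
elim: n => [//|n IH] /=.
by under eq_integral do rewrite IH; exact: integral0.
Qed.

Definition ball_bound n (L K : R) (z : 'rV[R]_n) : R :=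
  K * (`|z| <= L)%R%:R.

Lemma ball_bound_ge0 n (L K : R) (z : 'rV[R]_n) : 0 <= K -> 0 <= ball_bound L K z.
Proof. by move=> K0; rewrite mulr_ge0. Qed.

Lemma jmeas_ball_bound n d (S : measurableType d) (L K : R) :
  jmeas (fun (_ : S) (v : 'rV[R]_n) => ball_bound L K v).
Proof.
apply: (@jmeas_comp _ _ _ _ _ _ _ _ (fun x : R => K * (x <= L)%R%:R)
  (fun (_ : S) (v : 'rV[R]_n) => `|v|)).
  apply: measurable_funM => //.
  rewrite (_ : (fun x => _) = (fun x : R => if x <= L then 1 else 0)); last first.
    by apply/funext => x; case: (x <= L).
  by apply: measurable_fun_ifT => //; exact: measurable_fun_ler.
by apply: jmeas_continuous; exact: norm_continuous.
Qed.

(** As [|z|] is the maximum norm, the ball is a cube: the slice at [t] vanishes for |t| > L and is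
    otherwise at most the same bound in one dimension less. *)
Lemma lebint_ball_bound_lty n (L K : R) : 0 <= K -> 0 <= L ->
  (lebint (fun z : 'rV[R]_n => (ball_bound L K z)%:E) < +oo)%E.
Proof.
move=> K0 L0; elim: n => [|n IH] /=; first by rewrite ltry.
have b0 k (v : 'rV[R]_k) : (0 <= (ball_bound L K v)%:E)%E.
  by rewrite lee_fin ball_bound_ge0.
have mN k : jmeas (fun (_ : unit) (v : 'rV[R]_k) => (ball_bound L K v)%:E).
  by apply: (jmeas_comp _ (jmeas_ball_bound _ _ _ _)); exact/measurable_EFinP.
pose c := fine (lebint (fun v : 'rV[R]_n => (ball_bound L K v)%:E)).
have cE : lebint (fun v : 'rV[R]_n => (ball_bound L K v)%:E) = c%:E.
  by rewrite fineK// ge0_fin_numE// lebint_ge0.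
have c0 : 0 <= c by rewrite -lee_fin -cE lebint_ge0.
suff h : (\int[@lebesgue_measure R]_t lebint (fun v : 'rV[R]_n => (ball_bound L K (consrow t v))%:E) <=
          \int[@lebesgue_measure R]_(t in `[(- L)%R, L]) c%:E)%E.
  apply: (le_lt_trans h); rewrite integral_cst//= lebesgue_measure_itv/=.
  by case: ifPn => _; rewrite ?mule0 -?EFinD -?EFinM ltry.
rewrite [leRHS]integral_mkcond.
apply: ge0_le_integral => //.
- by move=> t _; apply: lebint_ge0.
- exact: (measurable_lebint_head (S := unit) tt (fun _ => b0 n.+1) (mN n.+1)).
- by apply/(measurable_restrictT _ _).1 => //.
move=> t _; rewrite patchE; case: ifPn => tL.
  rewrite -cE.
  apply: (le_lebint (S := unit) (f := fun _ v => (ball_bound L K (consrow t v))%:E) (g := fun _ v => (ball_bound L K v)%:E) tt) => //.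
  - have mt : measurable_fun setT (fun u : unit => (u, t) : unit * measurableTypeR R).
      by apply: measurable_fun_pair => //.
    exact: (jmeas_precomp mt (mN n.+1)).
  - move=> _ v; rewrite lee_fin /ball_bound ler_wpM2l// ler_nat.
    case: (leP `|consrow t v| L) => // h.
    by rewrite (le_trans (normr_consrow t v).2 h).
rewrite (_ : (fun v => _) = (fun _ => 0%:E)) ?lebint0//.
apply/funext => v; congr EFin; rewrite /ball_bound.
case: (leP `|consrow t v| L) => h; last by rewrite mulr0.
move: tL; rewrite notin_setE/= in_itv/= => /negP; rewrite -ler_norml.
by rewrite (le_trans (normr_consrow t v).1 h).
Qed.

(** The excluded hyperplane is a single point for the outermost integral, hence null. This disposes
    of the values that powers, inverses and derivatives of [rho] take on {x = 0}. *)
Lemma eq_lebint_head n (f g : 'rV[R]_n.+1 -> \bar R) :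
  (forall z : 'rV[R]_n.+1, z ord0 ord0 != 0 -> f z = g z) ->
  (forall z, 0 <= g z)%E -> jmeas (fun _ : unit => g) -> lebint f = lebint g.
Proof.
move=> fg g0 mg /=.
have mg' := measurable_lebint_head (S := unit) tt (fun _ => g0) mg.
(* The slice integrals of [f] inherit measurability from those of [g], as they differ at the single
   point t = 0. *)
have fE : (fun t => lebint (fun v => f (consrow t v))) =
  (fun t => if t == 0 then lebint (fun v => f (consrow 0 v))
            else lebint (fun v => g (consrow t v))).
  apply/funext => t; case: eqVneq => [->//|t0].
  by congr lebint; apply/funext => v; apply: fg; rewrite consrow0.
apply: ae_eq_integral => //.
  rewrite fE; apply: measurable_fun_ifT => //.
  apply: (measurable_fun_bool true); rewrite setTI.
  rewrite (_ : _ @^-1` _ = [set 0]); last first.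
    by apply/seteqP; split => x /=; [move/eqP|move=> ->; exact/eqP].
  exact: measurable_set1.
exists [set 0]; split.
- exact: measurable_set1.
- exact: lebesgue_measure_set1.
move=> t /=; apply: contra_notP => /eqP t0 _.
by congr lebint; apply/funext => v; apply: fg; rewrite consrow0.
Qed.

End lebint_derivative.

(** * Integrating an inequality that holds up to a divergence *)

Section divergence.
Context (R : realType).

Section jmeas_real.
Context (n : nat) d (S : measurableType d).
Implicit Types f g : S -> 'rV[R]_n -> R.

Lemma jmeas_EFin f : jmeas f -> jmeas (fun s v => (f s v)%:E).
Proof. by apply: jmeas_comp; exact/measurable_EFinP. Qed.

Lemma jmeas_funD f g : jmeas f -> jmeas g -> jmeas (fun s v => f s v + g s v).
Proof.
move=> mf mg.
apply: (@jmeas_comp _ _ _ _ _ _ _ _ (fun x : R * R => x.1 + x.2)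
  (fun s v => (f s v, g s v))); last exact: jmeas_pair.
by apply: measurable_funD; [exact: measurable_fst|exact: measurable_snd].
Qed.

Lemma jmeas_funM f g : jmeas f -> jmeas g -> jmeas (fun s v => f s v * g s v).
Proof.
move=> mf mg.
apply: (@jmeas_comp _ _ _ _ _ _ _ _ (fun x : R * R => x.1 * x.2)
  (fun s v => (f s v, g s v))); last exact: jmeas_pair.
by apply: measurable_funM; [exact: measurable_fst|exact: measurable_snd].
Qed.

Lemma jmeas_sum (I : Type) (r : seq I) (f : I -> S -> 'rV[R]_n -> R) :
  (forall i, jmeas (f i)) -> jmeas (fun s v => \sum_(i <- r) f i s v).
Proof.
move=> mf; elim: r => [|i r IH].
  rewrite (_ : (fun s v => _) = (fun _ _ => 0)).
    by apply: (@jmeas_continuous R n _ S (cst 0)) => v; exact: cst_continuous.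
  by apply/funext => s; apply/funext => v; rewrite big_nil.
rewrite (_ : (fun s v => _) = (fun s v => f i s v + \sum_(j <- r) f j s v)).
  exact: jmeas_funD.
by apply/funext => s; apply/funext => v; rewrite big_cons.
Qed.

Lemma lebint_sum (I : Type) (r : seq I) (f : I -> S -> 'rV[R]_n -> R) s :
  (forall i s v, 0 <= f i s v) -> (forall i, jmeas (f i)) ->
  (lebint (fun v => (\sum_(i <- r) f i s v)%:E) =
   \sum_(i <- r) lebint (fun v => (f i s v)%:E))%E.
Proof.
move=> f0 mf; elim: r => [|i r IH].
  rewrite big_nil; apply: (etrans _ (lebint0 R n)); congr lebint.
  by apply/funext => v; rewrite big_nil.
rewrite big_cons -IH -(lebintD s (f := fun s v => (f i s v)%:E)
  (g := fun s v => (\sum_(j <- r) f j s v)%:E)).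
- by congr lebint; apply/funext => v; rewrite big_cons.
- by move=> *; rewrite lee_fin.
- by move=> *; rewrite lee_fin sumr_ge0.
- exact: jmeas_EFin.
- by apply: jmeas_EFin; exact: jmeas_sum.
Qed.

End jmeas_real.

Lemma compact_normr_le n (L : R) : compact [set z : 'rV[R]_n | `|z| <= L].
Proof.
apply: bounded_closed_compact.
  by exists L; split; [exact: num_real|move=> M LM z /= zL; exact: (le_trans zL (ltW LM))].
rewrite (_ : [set _ | _] = (fun z : 'rV[R]_n => `|z|) @^-1` [set x | x <= L])//.
by apply: closed_comp; [move=> z _; exact: norm_continuous|exact: closed_le].
Qed.

Lemma continuous_supported_bounded n (f : 'rV[R]_n -> R) (L : R) :
  continuous f -> 0 <= L -> (forall z, L < `|z| -> f z = 0) ->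
  exists2 K : R, 0 <= K & forall z, `|f z| <= K.
Proof.
move=> cf L0 f0.
have cA := compact_normr_le (n := n) (L := L).
have [||c _ cmax] := @EVT_max_rV _ _ (fun z => `|f z|) _ _ cA.
- by exists 0; rewrite /= normr0.
- apply: continuous_subspaceT => z.
  by apply: continuous_comp; [exact: cf|exact: norm_continuous].
exists `|f c| => // z; have [zL|/f0 ->] := leP `|z| L; last by rewrite normr0.
by apply: cmax; rewrite inE.
Qed.

(** Each [G' i] is continuous with support in a ball, hence dominated by some [B i] of finite
    integral, and adding [G' i] to [B i] does not change that integral. *)
Lemma lebint_divergence_le n (D A : 'rV[R]_n -> R) (G G' : 'I_n -> 'rV[R]_n -> R)
    (L : R) :
  (forall z, 0 <= D z) -> (forall z, 0 <= A z) ->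
  jmeas (fun _ : unit => D) -> jmeas (fun _ : unit => A) -> 0 < L ->
  (forall i z, is_derive z (delta_mx ord0 i : 'rV[R]_n) (G i) (G' i z)) ->
  (forall i, continuous (G' i)) -> (forall i z, L <= `|z| -> G i z = 0) ->
  (forall z, A z <= D z + \sum_i G' i z) ->
  (lebint (fun z => (A z)%:E) <= lebint (fun z => (D z)%:E))%E.
Proof.
move=> D0 A0 mD mA L0 dG cG G0 AD.
have G'0 i z : L < `|z| -> G' i z = 0.
  move=> Lz; apply: (is_derive_near0 (dG i z)).
  by near=> u; apply: G0; apply: ltW; near: u; exact: (cvgr_gt _ (cvg_norm cvg_id) _ Lz).
have [K KP] : {K : 'I_n -> R & forall i, 0 <= K i /\ forall z, `|G' i z| <= K i}.
  apply: (@choice _ _ (fun i K => 0 <= K /\ forall z, `|G' i z| <= K)) => i.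
  by have [K] := continuous_supported_bounded (cG i) (ltW L0) (G'0 i); exists K.
pose B i (z : 'rV[R]_n) := ball_bound L (K i) z.
have B0 i z : 0 <= B i z by apply: ball_bound_ge0; exact: (KP i).1.
have GB i z : `|G' i z| <= B i z.
  rewrite /B /ball_bound; case: (leP `|z| L) => zL.
    by rewrite mulr1; exact: (KP i).2.
  by rewrite G'0// normr0 mulr0.
have GB0 i z : 0 <= G' i z + B i z by have := GB i z; rewrite ler_norml => /andP[]; lra.
have mB i : jmeas (fun _ : unit => B i) by exact: jmeas_ball_bound.
have mGB i : jmeas (fun (_ : unit) z => G' i z + B i z).
  by apply: jmeas_funD => //; exact: jmeas_continuous.
have LB i : lebint (fun z => (G' i z + B i z)%:E) = lebint (fun z => (B i z)%:E).
  exact: (lebint_addl_derivative (dG i) (cG i) L0 (G0 i) (mB i) (GB i)).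
have fB : (\sum_i lebint (fun z => (B i z)%:E) \is a fin_num)%E.
  apply/sum_fin_numP => i _ _; rewrite ge0_fin_numE.
    by apply: lebint_ball_bound_lty; [exact: (KP i).1|exact: ltW].
  by apply: lebint_ge0 => z; rewrite lee_fin.
(* The finite sum of the integrals of [B i] is added on both sides. On the right it is replaced by
   that of [G' i + B i], and the claim becomes monotonicity for nonnegative integrands. *)
rewrite -(leeD2rE _ _ fB).
have -> : (\sum_i lebint (fun z => (B i z)%:E) = lebint (fun z => (\sum_i B i z)%:E))%E.
  by rewrite (lebint_sum _ tt (f := fun i _ => B i)).
rewrite -(lebintD tt (f := fun _ z => (A z)%:E) (g := fun _ z => (\sum_i B i z)%:E)); last 4 first.
- by move=> *; rewrite lee_fin.
- by move=> *; rewrite lee_fin sumr_ge0.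
- exact: jmeas_EFin.
- by apply: jmeas_EFin; exact: (jmeas_sum _ (f := fun i _ => B i)).
have -> : (lebint (fun z => (\sum_i B i z)%:E) = lebint (fun z => (\sum_i (G' i z + B i z))%:E))%E.
  rewrite (lebint_sum _ tt (f := fun i _ => B i))//.
  rewrite (lebint_sum _ tt (f := fun i _ z => G' i z + B i z))//.
  by apply: eq_bigr => i _.
rewrite -(lebintD tt (f := fun _ z => (D z)%:E) (g := fun _ z => (\sum_i (G' i z + B i z))%:E)); last 4 first.
- by move=> *; rewrite lee_fin.
- by move=> *; rewrite lee_fin sumr_ge0.
- exact: jmeas_EFin.
- by apply: jmeas_EFin; exact: (jmeas_sum _ (f := fun i _ z => G' i z + B i z)).
apply: (le_lebint (f := fun _ z => ((A z)%:E + (\sum_i B i z)%:E)%E)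
  (g := fun _ z => ((D z)%:E + (\sum_i (G' i z + B i z))%:E)%E) tt).
- by move=> *; rewrite lee_fin addr_ge0// sumr_ge0.
- by move=> *; rewrite lee_fin addr_ge0// sumr_ge0.
- apply: (jmeas_EFin (f := fun _ z => A z + \sum_i B i z)); apply: jmeas_funD => //.
  exact: (jmeas_sum _ (f := fun i _ => B i)).
- apply: (jmeas_EFin (f := fun _ z => D z + \sum_i (G' i z + B i z))); apply: jmeas_funD => //.
  exact: (jmeas_sum _ (f := fun i _ z => G' i z + B i z)).
- by move=> _ z; rewrite lee_fin big_split/= addrA lerD2r.
Unshelve. all: by end_near. Qed.

End divergence.

(** * Directional derivatives and the cutoff *)

Section real_calculus.
Context (R : realType) (V : normedModType R).
Implicit Types (f g : V -> R) (x v : V) (df dg : R).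

Lemma is_derive_fmul f g x v df dg : is_derive x v f df -> is_derive x v g dg ->
  is_derive x v (fun z => f z * g z) (df * g x + f x * dg).
Proof.
move=> fdf gdg; apply: is_derive_eq (is_deriveM fdf gdg) _.
by rewrite /GRing.scale/= addrC mulrC.
Qed.

Lemma is_derive_fadd f g x v df dg : is_derive x v f df -> is_derive x v g dg ->
  is_derive x v (fun z => f z + g z) (df + dg).
Proof. by move=> fdf gdg; exact: is_deriveD. Qed.

Lemma is_derive_fcst (c : R) x v : is_derive x v (fun _ => c) 0.
Proof. exact: is_derive_cst. Qed.

Lemma is_derive_fsum n (h : 'I_n -> V -> R) (dh : 'I_n -> R) x v :
  (forall i, is_derive x v (h i) (dh i)) ->
  is_derive x v (fun z => \sum_i h i z) (\sum_i dh i).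
Proof.
move=> hd; have -> : (fun z => \sum_i h i z) = \sum_i h i.
  by apply/funext => z; rewrite fct_sumE.
exact: is_derive_sum.
Qed.

(** Only a directional derivative of [f] is given, so the one-variable chain rule is applied along
    the line s *: v + x. *)
Lemma is_derive_chain f (h : R -> R) x v df (dh : R) : is_derive x v f df ->
  is_derive (f x) (1 : R) h dh -> is_derive x v (fun z => h (f z)) (dh * df).
Proof.
move=> fdf hdh.
pose l (s : R) := s *: v + x.
have l0 : l 0 = x by rewrite /l scale0r add0r.
have fl : is_derive (0 : R) (1 : R) (f \o l) df.
  apply: (is_derive_line (w := v)); last by rewrite l0.
  by move=> s; rewrite l0 /l addr0 [s *: 1]mulr1.
have hl : is_derive (0 : R) (1 : R) (h \o (f \o l)) (dh * df).
  have hdh' : is_derive ((f \o l) 0) (1 : R) h dh by rewrite /= l0.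
  have [flD flE] := fl; have [hD hE] := hdh'.
  apply: DeriveDef.
    apply/derivable1_diffP; apply: differentiable_comp; exact/derivable1_diffP.
  by rewrite -derive1E derive1_comp// !derive1E flE hE.
have [hlD hlE] := hl.
have E : (fun s : R => s^-1 *: (((h \o (f \o l)) \o shift 0) (s *: 1) - (h \o (f \o l)) 0)) =
         (fun s : R => s^-1 *: (((fun z => h (f z)) \o shift x) (s *: v) - h (f x))).
  by apply/funext => s /=; rewrite l0 /l addr0 [s *: 1]mulr1.
by apply: DeriveDef; [rewrite /derivable -E|rewrite /derive -E].
Qed.

(** The logarithmic form keeps the power intact and avoids the exponent n - 1, so that [field] can
    later treat the power as an atom. *)
Lemma is_derive_fexp f n x v df : f x != 0 -> is_derive x v f df ->
  is_derive x v (fun z => f z ^+ n) (f x ^+ n * (n%:R * df / f x)).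
Proof.
move=> fx0 fdf; rewrite (_ : (fun z => _) = f ^+ n); last by rewrite exprfctE.
apply: is_derive_eq (is_deriveX n fdf) _.
case: n => [|n]; first by rewrite !mul0r mulr0 scale0r.
rewrite /GRing.scale/= exprS; field.
exact: fx0.
Qed.

Lemma is_derive_fsqr f x v df : is_derive x v f df ->
  is_derive x v (fun z => f z ^+ 2) (2 * f x * df).
Proof.
move=> fdf; rewrite (_ : (fun z => _) = f ^+ 2); last by rewrite exprfctE.
by apply: is_derive_eq (is_deriveX 2 fdf) _; rewrite /GRing.scale/= expr1.
Qed.

Lemma is_derive_fpowR f (a : R) x v df : 0 < f x -> is_derive x v f df ->
  is_derive x v (fun z => f z `^ a) (f x `^ a * (a * df / f x)).
Proof.
move=> fx0 fdf.
apply: is_derive_eq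
  (is_derive_chain (h := fun u => u `^ a) fdf (is_derive1_powR a fx0)) _.
rewrite powRB ?lt0r_neq0 ?implybT// powRr1 ?ltW//; field.
exact: lt0r_neq0.
Qed.

Lemma is_derive_finv f x v df : f x != 0 -> is_derive x v f df ->
  is_derive x v (fun z => (f z)^-1) (- (f x)^-1 * (df / f x)).
Proof.
move=> fx0 fdf; apply: is_derive_eq.
  apply: DeriveDef; first exact: derivableV.
  exact: deriveV.
rewrite /GRing.scale/= (@derive_val _ _ _ _ _ _ _ fdf); field.
exact: fx0.
Qed.

End real_calculus.

Section cutoff.
Context (R : realType).

Definition sqpos (s : R) : R := Num.max 0 s ^+ 2.

Lemma is_derive_sqpos (s : R) : is_derive s (1 : R) sqpos (2 * Num.max 0 s).
Proof.
have [s0|s0|s0] := ltgtP s 0.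
- rewrite mulr0.
  apply: (near_eq_is_derive (f := cst 0)).
  near=> u; rewrite /sqpos max_l ?expr0n//; apply: ltW; near: u.
  exact: (cvgr_lt _ cvg_id _ s0).
- apply: (@near_eq_is_derive R R R (fun u : R => u ^+ 2) sqpos s 1 (2 * s)).
    near=> u; rewrite /sqpos max_r//; apply: ltW; near: u.
    exact: (cvgr_gt _ cvg_id _ s0).
  exact: is_derive_eq (is_derive_fsqr (f := id) (is_derive_id s (1 : R))) (mulr1 _).
- rewrite s0 mulr0.
  (* At the corner the difference quotient is 0 or h, so |h| bounds it. *)
  have c0 : h^-1 *: ((sqpos \o shift 0) (h *: (1 : R)) - sqpos 0) @[h --> 0^'] --> (0 : R).
    apply/cvgrPdist_le => /= e e0; near=> h.
    have h0 : h != 0 by near: h; exact: nbhs_dnbhs_neq.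
    rewrite sub0r normrN addr0 [h *: 1]mulr1 {2}/sqpos maxxx expr0n/= subr0.
    rewrite [_ *: _]mulrC /sqpos.
    apply: (@le_trans _ _ `|h|); last first.
      by near: h; apply: dnbhs0_le.
    have [hh|hh] := leP h 0; first by rewrite expr0n mul0r normr0.
    by rewrite expr2 mulfK.
  by apply: DeriveDef; [apply/cvg_ex; exists 0|apply/cvg_lim].
Unshelve. all: by end_near. Qed.

(** Evaluated at p = |x|^2. The shift makes it vanish for p <= e, the square makes its derivative
    continuous, and the denominator keeps it below 1. Using [e] in both places makes it monotone in
    [e]. *)
Definition cutoff (e p : R) : R := sqpos (p - e) / (sqpos (p - e) + e).

Definition dcutoff (e p : R) : R :=
  2 * Num.max 0 (p - e) * e / (sqpos (p - e) + e) ^+ 2.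

Lemma sqpos_ge0 (s : R) : 0 <= sqpos s. Proof. exact: sqr_ge0. Qed.

Lemma is_derive_cutoff (e p : R) : 0 < e ->
  is_derive p (1 : R) (cutoff e) (dcutoff e p).
Proof.
move=> e0.
have s0 : (fun p => sqpos (p - e) + e) p != 0 by rewrite lt0r_neq0// ltr_wpDl// sqpos_ge0.
have sd : is_derive p (1 : R) (fun p => sqpos (p - e)) (2 * Num.max 0 (p - e)).
  apply: is_derive_eq (is_derive_chain (f := fun p => p - e)
    (is_derive_fadd (is_derive_id p (1 : R)) (is_derive_fcst (- e) p (1 : R)))
    (is_derive_sqpos _)) _.
  by rewrite addr0 mulr1.
have td := is_derive_fadd sd (is_derive_fcst e p (1 : R)).
have cd := is_derive_fmul sd (is_derive_finv (f := fun p => sqpos (p - e) + e) s0 td).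
apply: (@is_derive_eq R R R (cutoff e) p 1 _ _ cd).
rewrite addr0 /dcutoff; field.
exact: s0.
Qed.

Lemma cutoff_ge0 (e p : R) : 0 < e -> 0 <= cutoff e p.
Proof. by move=> e0; rewrite divr_ge0 ?addr_ge0 ?sqpos_ge0// ltW. Qed.

Lemma cutoff_le1 (e p : R) : 0 < e -> cutoff e p <= 1.
Proof.
move=> e0; rewrite ler_pdivrMr ?mul1r; first by rewrite lerDl ltW.
by rewrite ltr_wpDl ?sqpos_ge0.
Qed.

Lemma dcutoff_ge0 (e p : R) : 0 < e -> 0 <= dcutoff e p.
Proof. by move=> e0; rewrite divr_ge0 ?sqr_ge0// mulr_ge0 ?(ltW e0)// mulr_ge0// le_max lexx. Qed.

Lemma cutoff_eq0 (e p : R) : p <= e -> cutoff e p = 0.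
Proof. by move=> pe; rewrite /cutoff /sqpos max_l ?subr_le0// expr0n mul0r. Qed.

Lemma dcutoff_eq0 (e p : R) : p <= e -> dcutoff e p = 0.
Proof. by move=> pe; rewrite /dcutoff max_l ?subr_le0// mulr0 !mul0r. Qed.

(** s / (s + e) increases with s and decreases with e, and s = sqpos (p - e) itself grows as e
    shrinks. *)
Lemma cutoff_anti (e e' p : R) : 0 < e' -> e' <= e -> cutoff e p <= cutoff e' p.
Proof.
move=> e'0 ee'; have e0 := lt_le_trans e'0 ee'.
have s0 := sqpos_ge0 (p - e); have s0' := sqpos_ge0 (p - e').
have ss : sqpos (p - e) <= sqpos (p - e').
  have mm : Num.max 0 (p - e) <= Num.max 0 (p - e').
    by rewrite ge_max !le_max lexx/= lerB ?orbT.
  by apply: lerXn2r => //; rewrite nnegrE le_max lexx.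
rewrite ler_pdivrMr ?ltr_wpDl// mulrAC ler_pdivlMr ?ltr_wpDl//.
by have := ler_pM s0 (ltW e'0) ss ee'; lra.
Qed.

Lemma cvg_cutoff (p : R) : 0 < p ->
  cutoff (N.+1%:R^-1) p @[N --> \oo] --> (1 : R).
Proof.
move=> p0.
have c1 : (p - N.+1%:R^-1) @[N --> \oo] --> p.
  rewrite -[X in _ --> X]subr0; apply: cvgB; first exact: cvg_cst.
  exact: cvg_harmonic.
have c2 : sqpos (p - N.+1%:R^-1) @[N --> \oo] --> sqpos p.
  apply: (@cvg_comp _ _ _ (fun N => p - N.+1%:R^-1) sqpos); first exact: c1.
  apply: differentiable_continuous; apply/derivable1_diffP.
  by have [] := is_derive_sqpos p.
have sp : sqpos p != 0 by rewrite /sqpos max_r ?ltW// expf_neq0// lt0r_neq0.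
have c3 : sqpos (p - N.+1%:R^-1) + N.+1%:R^-1 @[N --> \oo] --> sqpos p.
  by rewrite -[X in _ --> X]addr0; apply: cvgD => //; exact: cvg_harmonic.
by rewrite -[X in _ --> X](divff sp); apply: cvgM => //; exact: cvgV.
Qed.

End cutoff.

(** * The vector field *)

Section grushin.
Context (R : realType) (m k : nat).
Implicit Types z v : 'rV[R]_(m + k).

Definition sqx z : R := \sum_(i < m) z ord0 (lshift k i) ^+ 2.
Definition sqy z : R := \sum_(j < k) z ord0 (rshift m j) ^+ 2.

Lemma sqx_ge0 z : 0 <= sqx z. Proof. by apply: sumr_ge0 => i _; exact: sqr_ge0. Qed.
Lemma sqy_ge0 z : 0 <= sqy z. Proof. by apply: sumr_ge0 => i _; exact: sqr_ge0. Qed.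

Lemma enorm_xpart z : enorm (xpart z) = Num.sqrt (sqx z).
Proof. by congr Num.sqrt; apply: eq_bigr => i _; rewrite mxE. Qed.

Lemma enorm_ypart z : enorm (ypart z) = Num.sqrt (sqy z).
Proof. by congr Num.sqrt; apply: eq_bigr => i _; rewrite mxE. Qed.

Lemma is_derive_coord n (z v : 'rV[R]_n) j :
  is_derive z v (fun z : 'rV[R]_n => z ord0 j) (v ord0 j).
Proof.
apply: (is_derive_line (G := id) (k := fun z : 'rV[R]_n => z ord0 j)).
by move=> h; rewrite !mxE.
Qed.

Lemma is_derive_sqx z (j : 'I_(m + k)) : is_derive z (delta_mx ord0 j : 'rV[R]_(m + k)) sqx
  (2 * (if fintype.split j is inl _ then 1 else 0) * z ord0 j).
Proof.
apply: is_derive_eq (is_derive_fsum (fun i => is_derive_fsqr (is_derive_coord _ _ (lshift k i)))) _.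
case: fintype.splitP => [i|i] ji.
  have -> : j = lshift k i by exact: val_inj.
  rewrite (bigD1 i)//= mxE !eqxx mulr1n big1 ?addr0; first by rewrite !mulr1.
  by move=> i' i'i; rewrite mxE (inj_eq (@lshift_inj _ _)) (negbTE i'i) mulr0.
rewrite mulr0 mul0r big1// => i' _; rewrite mxE.
have -> : j = rshift m i by exact: val_inj.
by rewrite eq_lrshift mulr0.
Qed.

Lemma is_derive_sqy z (j : 'I_(m + k)) : is_derive z (delta_mx ord0 j : 'rV[R]_(m + k)) sqy
  (2 * (if fintype.split j is inl _ then 0 else 1) * z ord0 j).
Proof.
apply: is_derive_eq (is_derive_fsum (fun i => is_derive_fsqr (is_derive_coord _ _ (rshift m i)))) _.
case: fintype.splitP => [i|i] ji.
  rewrite mulr0 mul0r big1// => i' _; rewrite mxE.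
  have -> : j = lshift k i by exact: val_inj.
  by rewrite eq_rlshift mulr0.
have -> : j = rshift m i by exact: val_inj.
rewrite (bigD1 i)//= mxE !eqxx mulr1n big1 ?addr0; first by rewrite !mulr1.
by move=> i' i'i; rewrite mxE (inj_eq (@rshift_inj _ _)) (negbTE i'i) mulr0.
Qed.

Lemma continuous_fsum n I (r : seq I) (h : I -> 'rV[R]_n -> R) :
  (forall i, continuous (h i)) -> continuous (fun u => \sum_(i <- r) h i u).
Proof.
move=> ch; elim: r => [|i r IH].
  rewrite (_ : (fun u => _) = cst 0); last by apply/funext => u; rewrite big_nil.
  by move=> u; exact: cst_continuous.
rewrite (_ : (fun u => _) = (fun u => h i u + \sum_(j <- r) h j u)).
  by move=> u; apply: continuousD; [exact: ch|exact: IH].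
by apply/funext => u; rewrite big_cons.
Qed.

Lemma continuous_sqx : continuous sqx.
Proof.
apply: continuous_fsum => i z.
apply: (continuous_comp (g := fun u : R => u ^+ 2)); first exact: coord_continuous.
exact: exprn_continuous.
Qed.

Lemma continuous_sqy : continuous sqy.
Proof.
apply: continuous_fsum => i z.
apply: (continuous_comp (g := fun u : R => u ^+ 2)); first exact: coord_continuous.
exact: exprn_continuous.
Qed.

Section fields.
Variables (gamma : nat) (a b c mu M : R).
Let g : R := gamma.+1%:R.

(** This is rho^(2(1+gamma)), a polynomial in the coordinates. *)
Definition gauge_pow z : R := sqx z ^+ gamma.+1 + g ^+ 2 * sqy z.
Definition weight z : R := sqx z `^ a * gauge_pow z `^ b.
Definition slope z : R := sqx z ^+ gamma * (gauge_pow z)^-1.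
Definition sqrho z : R := gauge_pow z `^ g^-1.

(* [fieldZ] multiplies the generator of the dilations, with components [x_i] and [(1 + gamma) y_j]; [fieldX] multiplies the field with components [x_i] and [0]. With [w = rho^alpha |grad rho|^t], [slope = |grad rho|^2 / rho^2] and [sqrho = rho^2], together they are [w] times [c grad rho / rho + mu (x + M rho grad rho)]. *)
Definition fieldZ z : R := weight z * slope z * (c + mu * M * sqrho z).
Definition fieldX z : R := mu * weight z.

(** Logarithmic derivative of [gauge_pow] in a direction along which [sqx] and [sqy] have
    derivatives p' and q'; the definitions below follow the same convention. *)
Definition dlogE z (p' q' : R) : R :=
  (g * sqx z ^+ gamma * p' + g ^+ 2 * q') * (gauge_pow z)^-1.
Definition dweight z p' q' : R :=
  weight z * (a * p' * (sqx z)^-1 + b * dlogE z p' q').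
Definition dslope z p' q' : R :=
  slope z * (gamma%:R * p' * (sqx z)^-1 - dlogE z p' q').
Definition dsqrho z p' q' : R := sqrho z * (g^-1 * dlogE z p' q').
Definition dfieldZ z p' q' : R :=
  (dweight z p' q' * slope z + weight z * dslope z p' q') * (c + mu * M * sqrho z)
  + weight z * slope z * (mu * M * dsqrho z p' q').
Definition dfieldX z p' q' : R := mu * dweight z p' q'.

Lemma gauge_pow_gt0 z : 0 < sqx z -> 0 < gauge_pow z.
Proof. by move=> p0; rewrite ltr_wpDr ?exprn_gt0// mulr_ge0 ?sqr_ge0// sqy_ge0. Qed.

Lemma gauge_pow_ge0 z : 0 <= gauge_pow z.
Proof. by rewrite addr_ge0 ?exprn_ge0 ?mulr_ge0 ?sqr_ge0 ?sqx_ge0 ?sqy_ge0. Qed.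

Let g0 : g != 0. Proof. by rewrite pnatr_eq0. Qed.

Section at_point.
Variables (z v : 'rV[R]_(m + k)) (p' q' : R).
Hypotheses (p0 : 0 < sqx z) (dp : is_derive z v sqx p') (dq : is_derive z v sqy q').

Let pn0 : sqx z != 0. Proof. exact: lt0r_neq0. Qed.
Let E0 : 0 < gauge_pow z. Proof. exact: gauge_pow_gt0. Qed.
Let En0 : gauge_pow z != 0. Proof. exact: lt0r_neq0. Qed.

Lemma is_derive_gauge_pow :
  is_derive z v gauge_pow (gauge_pow z * dlogE z p' q').
Proof.
apply: is_derive_eq (is_derive_fadd (is_derive_fexp gamma.+1 pn0 dp)
  (is_derive_fmul (is_derive_fcst (g ^+ 2) z v) dq)) _.
rewrite /dlogE /g mul0r add0r exprS; field.
by apply/andP; split.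
Qed.

Lemma is_derive_weight : is_derive z v weight (dweight z p' q').
Proof.
apply: is_derive_eq (is_derive_fmul (is_derive_fpowR a p0 dp)
  (is_derive_fpowR b E0 is_derive_gauge_pow)) _.
rewrite /dweight /weight; field.
by apply/andP; split.
Qed.

Lemma is_derive_slope : is_derive z v slope (dslope z p' q').
Proof.
apply: is_derive_eq (is_derive_fmul (is_derive_fexp gamma pn0 dp)
  (is_derive_finv En0 is_derive_gauge_pow)) _.
rewrite /dslope /slope; field.
by apply/andP; split.
Qed.

Lemma is_derive_sqrho : is_derive z v sqrho (dsqrho z p' q').
Proof.
apply: is_derive_eq (is_derive_fpowR g^-1 E0 is_derive_gauge_pow) _.
rewrite /dsqrho /sqrho; field.
by apply/andP; split.
Qed.

Lemma is_derive_fieldZ : is_derive z v fieldZ (dfieldZ z p' q').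
Proof.
apply: is_derive_eq (is_derive_fmul (is_derive_fmul is_derive_weight is_derive_slope)
  (is_derive_fadd (is_derive_fcst c z v)
    (is_derive_fmul (is_derive_fcst (mu * M) z v) is_derive_sqrho))) _.
by rewrite /dfieldZ mul0r !add0r.
Qed.

Lemma is_derive_fieldX : is_derive z v fieldX (dfieldX z p' q').
Proof.
apply: is_derive_eq (is_derive_fmul (is_derive_fcst mu z v) is_derive_weight) _.
by rewrite /dfieldX mul0r !add0r.
Qed.

End at_point.

End fields.
End grushin.

(** * The scalar inequality *)

Section scalar_inequality.
Context (R : realType).

Lemma divergence_identity (m k w p P q E R2 g gm a b c mu M : R) :
  0 < p -> 0 < P -> 0 < E -> 0 < g -> E = p * P + g ^+ 2 * q -> g = gm + 1 ->
  2 * a + 2 * gm + 2 * (b - 1) * g + m + k * g = 2 * c ->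
  let T := P * E^-1 in let s := c + mu * M * R2 in
  let Z := w * T * s in
  let X := mu * w in
  let Zp := w * T * (a * p^-1 + gm * p^-1 + (b - 1) * g * P * E^-1) * s
            + w * T * (mu * M * R2 * P * E^-1) in
  let Zq := w * T * ((b - 1) * g ^+ 2 * E^-1) * s
            + w * T * (mu * M * R2 * g * E^-1) in
  let Xp := mu * w * (a * p^-1 + b * g * P * E^-1) in
  2 * p * (Zp + Xp) + m * (Z + X) + 2 * q * (g * Zq) + k * (g * Z)
  = w * (2 * c * T * s + 2 * T * mu * M * R2
         + mu * (m + 2 * a + 2 * b * g * p * T)).
Proof.
move=> p0 P0 E0 g0 EE gE hc /=.
have pn0 : p != 0 by rewrite gt_eqF.
have En0 : E != 0 by rewrite gt_eqF.
have gn0 : g != 0 by rewrite gt_eqF.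
have -> : q = (E - p * P) / g ^+ 2 by rewrite EE; field.
have -> : c = (2 * a + 2 * gm + 2 * (b - 1) * g + m + k * g) / 2 by rewrite hc; field.
field.
by apply/and3P; split.
Qed.

(** The left side is w |F|^2 written with the flux components K x_i and g Z y_j; dividing by P
    undoes the factor |x|^gamma in the latter. *)
Lemma energy_identity (w p P q E g T s mu : R) :
  0 < w -> 0 < P -> 0 < E -> 0 < g -> E = p * P + g ^+ 2 * q -> T = P * E^-1 ->
  let Z := w * T * s in let K := Z + mu * w in
  K ^+ 2 * p / w + (g * Z) ^+ 2 * q / (w * P)
  = w * (T * s ^+ 2 + 2 * T * s * mu * p + mu ^+ 2 * p).
Proof.
move=> w0 P0 E0 g0 EE TE /=.
have wn0 : w != 0 by rewrite gt_eqF.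
have Pn0 : P != 0 by rewrite gt_eqF.
have En0 : E != 0 by rewrite gt_eqF.
have gn0 : g != 0 by rewrite gt_eqF.
have -> : q = (E - p * P) / g ^+ 2 by rewrite EE; field.
rewrite TE; field.
by apply/and4P; split.
Qed.

(* [bg * p * T], whose sign is unknown, is absorbed by [M] because [p <= R2]; [delta] is chosen so that the terms linear in [mu] beat the quadratic ones. *)
Lemma remainder_bound (m p R2 r2 a bg c M T delta mu s : R) :
  0 < m + 2 * a -> 0 < r2 -> 0 < T -> 0 < p -> 0 <= M ->
  T * R2 <= 1 -> p <= R2 -> R2 <= r2 ->
  `|2 * bg - 2 * c| <= 2 * M -> delta = (m + 2 * a) / (2 * (M + 1) ^+ 2) ->
  mu = delta / r2 -> s = c + mu * M * R2 ->
  c ^+ 2 * T + delta * (m + 2 * a) / 2 / r2 <=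
  2 * c * T * s + 2 * T * mu * M * R2 + mu * (m + 2 * a + 2 * bg * p * T)
  - (T * s ^+ 2 + 2 * T * s * mu * p + mu ^+ 2 * p).
Proof.
move=> ma0 r20 T0 p0 M0 TR pR Rr hM dE mE sE.
have M10 : 0 < (M + 1) ^+ 2 by rewrite exprn_gt0// ltr_wpDl.
have d0 : 0 < delta by rewrite dE divr_gt0// mulr_gt0.
have mu0 : 0 < mu by rewrite mE divr_gt0.
have R0 : 0 < R2 by exact: lt_le_trans pR.
have maE : m + 2 * a = 2 * delta * (M + 1) ^+ 2.
  rewrite dE; field.
  by rewrite gt_eqF// ltr_wpDl.
have muE : mu * r2 = delta by rewrite mE mulfVK// gt_eqF.
have kE : delta * (m + 2 * a) / 2 / r2 = mu * (mu * r2 * (M + 1) ^+ 2).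
  by rewrite muE maE mE; field; rewrite gt_eqF.
rewrite kE.
have -> : m + 2 * a + 2 * bg * p * T = 2 * (mu * r2) * (M + 1) ^+ 2 + 2 * bg * p * T.
  by rewrite maE muE.
have Tp0 : 0 <= T * p by rewrite mulr_ge0// ltW.
have TpTR : T * p <= T * R2 by rewrite ler_pM2l.
have h1 : - (2 * M * (T * R2)) <= (2 * bg - 2 * c) * (T * p).
  have : - (2 * M * (T * p)) <= (2 * bg - 2 * c) * (T * p).
    rewrite -mulNr; apply: ler_wpM2r => //.
    by move: hM; rewrite ler_norml => /andP[].
  apply: le_trans; rewrite lerN2; apply: ler_wpM2l => //.
  by rewrite mulr_ge0.
have h2 : T * M ^+ 2 * R2 ^+ 2 + 2 * T * M * R2 * p + p <= r2 * (M + 1) ^+ 2.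
  have e1 : T * M ^+ 2 * R2 ^+ 2 <= M ^+ 2 * r2.
    rewrite (_ : T * M ^+ 2 * R2 ^+ 2 = M ^+ 2 * (T * R2 * R2)); last by ring.
    apply: ler_wpM2l; first exact: sqr_ge0.
    by apply: le_trans Rr; rewrite ler_piMl// ltW.
  have e2 : 2 * T * M * R2 * p <= 2 * M * r2.
    rewrite (_ : 2 * T * M * R2 * p = 2 * M * (T * R2 * p)); last by ring.
    apply: ler_wpM2l; first by rewrite mulr_ge0.
    apply: le_trans (le_trans pR Rr).
    by rewrite ler_piMl// ltW.
  by nra.
rewrite -subr_ge0.
(* With s = c + mu M R2, the terms free of mu cancel through 2 c s - s^2 = c^2 - (mu M R2)^2. What
   remains is a part linear in mu, nonnegative by [h1], and a quadratic part, nonnegative by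
   [h2]. *)
rewrite (_ : _ - _ = mu * (2 * M * (T * R2) + (2 * bg - 2 * c) * (T * p))
  + mu ^+ 2 * (r2 * (M + 1) ^+ 2 - (T * M ^+ 2 * R2 ^+ 2 + 2 * T * M * R2 * p + p))); last first.
  by rewrite sE; ring.
apply: addr_ge0; apply: mulr_ge0; rewrite ?sqr_ge0 ?(ltW mu0)//; lra.
Qed.

(** The square is taken at f = eta K phi / w, so its quadratic term carries eta^2; eta^2 <= eta
    brings this to the single factor eta that multiplies the divergence of the field. *)
Lemma completed_square (w eta phi N X p K : R) :
  0 < w -> 0 <= eta -> eta <= 1 -> 0 <= p ->
  (forall f : R, 0 <= N + 2 * f * X + f ^+ 2 * p) ->
  - (eta * phi ^+ 2 * (K ^+ 2 * p / w)) <= w * N + 2 * eta * K * phi * X.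
Proof.
move=> w0 e0 e1 p0 h.
have wn0 : w != 0 by rewrite gt_eqF.
have := h (eta * K * phi / w).
move/(ler_wpM2l (ltW w0)); rewrite mulr0.
rewrite (_ : w * (N + 2 * _ * X + _) = w * N + 2 * eta * K * phi * X + eta ^+ 2 * (phi ^+ 2 * (K ^+ 2 * p / w))); last first.
  by field.
have : eta ^+ 2 * (phi ^+ 2 * (K ^+ 2 * p / w)) <= eta * (phi ^+ 2 * (K ^+ 2 * p / w)).
  apply: ler_wpM2r.
    by rewrite mulr_ge0 ?sqr_ge0// divr_ge0 ?(ltW w0)// mulr_ge0 ?sqr_ge0.
  by rewrite expr2 ler_piMl.
lra.
Qed.

Lemma sum_square_ge0 n (x d : 'I_n -> R) (f : R) :
  0 <= (\sum_i d i ^+ 2) + 2 * f * (\sum_i x i * d i) + f ^+ 2 * \sum_i x i ^+ 2.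
Proof.
rewrite !mulr_sumr -!big_split/=; apply: sumr_ge0 => i _.
rewrite (_ : _ + _ = (d i + f * x i) ^+ 2) ?sqr_ge0//; ring.
Qed.

End scalar_inequality.

Section continuity_at.
Context (R : realType) (V : normedModType R).
Implicit Types (f g : V -> R) (x : V).

Lemma cont_all f : (forall z, {for z, continuous f}) -> continuous f.
Proof. by []. Qed.

Lemma cont_mul f g x : {for x, continuous f} -> {for x, continuous g} ->
  {for x, continuous (fun z => f z * g z)}.
Proof. by move=> cf cg; exact: (continuousM cf cg). Qed.

Lemma cont_add f g x : {for x, continuous f} -> {for x, continuous g} ->
  {for x, continuous (fun z => f z + g z)}.
Proof. by move=> cf cg; exact: (continuousD cf cg). Qed.

Lemma cont_opp f x : {for x, continuous f} -> {for x, continuous (fun z => - f z)}.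
Proof. by move=> cf; exact: (continuousN cf). Qed.

Lemma cont_cst (c : R) x : {for x, continuous (fun _ : V => c)}.
Proof. exact: cst_continuous. Qed.

Lemma cont_exp f n x : {for x, continuous f} -> {for x, continuous (fun z => f z ^+ n)}.
Proof.
move=> cf; apply: (continuous_comp (g := fun u : R => u ^+ n)) => //.
exact: exprn_continuous.
Qed.

Lemma cont_inv f x : f x != 0 -> {for x, continuous f} ->
  {for x, continuous (fun z => (f z)^-1)}.
Proof. by move=> f0 cf; exact: (continuousV f0 cf). Qed.

Lemma cont_powR f (a : R) x : 0 < f x -> {for x, continuous f} ->
  {for x, continuous (fun z => f z `^ a)}.
Proof.
move=> f0 cf; apply: (continuous_comp (g := fun u : R => u `^ a)) => //.
apply: differentiable_continuous; apply/derivable1_diffP.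
by have [] := is_derive1_powR a f0.
Qed.

End continuity_at.

(** * The truncated flux and the continuity of its derivatives *)

Section flux.
Context (R : realType) (m k gamma : nat).
Implicit Types (z : 'rV[R]_(m + k)) (j : 'I_(m + k)).
Variables (a b c mu M e : R) (phi : 'rV[R]_(m + k) -> R).
Hypothesis e0 : 0 < e.
Hypothesis dphi : forall z, differentiable phi z.
Hypothesis cdphi : forall v, continuous (fun z => derive phi z v).

Let g : R := gamma.+1%:R.

Definition isx j : R := if fintype.split j is inl _ then 1 else 0.
Definition isy j : R := if fintype.split j is inl _ then 0 else 1.
(** Exponent of the coordinate under the dilations (x, y) -> (l x, l^(1+gamma) y). *)
Definition homdeg j : R := if fintype.split j is inl _ then 1 else g.

Definition field j z : R :=
  homdeg j * fieldZ gamma a b c mu M z + isx j * fieldX gamma a b mu z.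

Definition dfield j z : R :=
  let p' := 2 * isx j * z ord0 j in let q' := 2 * isy j * z ord0 j in
  homdeg j * dfieldZ gamma a b c mu M z p' q' + isx j * dfieldX gamma a b mu z p' q'.

Definition flux j z : R :=
  cutoff e (sqx z) * field j z * z ord0 j * phi z ^+ 2.

Definition dflux j z : R :=
  ((dcutoff e (sqx z) * (2 * isx j * z ord0 j) * field j z
    + cutoff e (sqx z) * dfield j z) * z ord0 j
   + cutoff e (sqx z) * field j z) * phi z ^+ 2
  + cutoff e (sqx z) * field j z * z ord0 j
    * (2 * phi z * derive phi z (delta_mx ord0 j)).

Lemma near_sqx_lt z : sqx z = 0 -> \forall u \near z, sqx u < e.
Proof.
move=> z0; have ze : sqx z < e by rewrite z0.
exact: (cvgr_lt _ (continuous_sqx (x := z)) _ ze).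
Qed.

Lemma is_derive_flux j z :
  is_derive z (delta_mx ord0 j : 'rV[R]_(m + k)) (flux j) (dflux j z).
Proof.
have [p0|] := ltrP 0 (sqx z); last first.
  move=> pz; have z0 : sqx z = 0 by apply/eqP; rewrite eq_le pz sqx_ge0.
  (* At x = 0 the inverses and powers in [dflux] take default values, which the vanishing cutoff and
     its vanishing derivative erase. *)
  have -> : dflux j z = 0.
    by rewrite /dflux cutoff_eq0 ?dcutoff_eq0 ?z0 ?ltW// !mul0r !addr0 !mul0r.
  apply: (@near_eq_is_derive _ _ _ (cst 0)).
  apply: filterS (near_sqx_lt z0) => u ue.
  by rewrite /flux cutoff_eq0 ?mul0r// ltW.
have dp := is_derive_sqx z j; have dq := is_derive_sqy z j.
rewrite -/(isx j) in dp; rewrite -/(isy j) in dq.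
have dc := is_derive_chain dp (is_derive_cutoff (sqx z) e0).
have dZ := is_derive_fieldZ gamma a b c mu M p0 dp dq.
have dX := is_derive_fieldX gamma a b mu p0 dp dq.
have df := is_derive_fadd (is_derive_fmul (is_derive_fcst (homdeg j) z _) dZ)
                          (is_derive_fmul (is_derive_fcst (isx j) z _) dX).
have dz := is_derive_coord z (delta_mx ord0 j) j.
have dph : is_derive z (delta_mx ord0 j : 'rV[R]_(m + k)) phi (derive phi z (delta_mx ord0 j)).
  by apply: derivableP; exact: diff_derivable.
have := is_derive_fmul (is_derive_fmul (is_derive_fmul dc df) dz) (is_derive_fsqr dph).
move=> d; apply: (@is_derive_eq _ _ _ (flux j) _ _ _ _ d).
rewrite mxE !eqxx mulr1 /dflux /dfield /field /=.
ring.
Qed.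

Section at_point.
Variable z : 'rV[R]_(m + k).
Hypothesis p0 : 0 < sqx z.

Let cp : {for z, continuous (@sqx R m k)}. Proof. exact: continuous_sqx. Qed.
Let cq : {for z, continuous (@sqy R m k)}. Proof. exact: continuous_sqy. Qed.
Let E0 : 0 < gauge_pow gamma z. Proof. exact: gauge_pow_gt0. Qed.

Let cpV : {for z, continuous (fun z => (@sqx R m k z)^-1)}.
Proof. by apply: cont_inv => //; rewrite lt0r_neq0. Qed.

Let cE : {for z, continuous (@gauge_pow R m k gamma)}.
Proof. by apply: cont_add; [exact: cont_exp|apply: cont_mul => //; exact: cont_cst]. Qed.

Let cEV : {for z, continuous (fun z => (@gauge_pow R m k gamma z)^-1)}.
Proof. by apply: cont_inv => //; rewrite lt0r_neq0. Qed.

Let cw : {for z, continuous (@weight R m k gamma a b)}.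
Proof. by apply: cont_mul; exact: cont_powR. Qed.

Let csl : {for z, continuous (@slope R m k gamma)}.
Proof. by apply: cont_mul => //; exact: cont_exp. Qed.

Let crho : {for z, continuous (@sqrho R m k gamma)}.
Proof. exact: cont_powR. Qed.

Let ccut : {for z, continuous (fun z : 'rV[R]_(m + k) => cutoff e (sqx z))}.
Proof.
apply: (continuous_comp (g := cutoff e)) => //.
apply: differentiable_continuous; apply/derivable1_diffP.
by have [] := is_derive_cutoff (sqx z) e0.
Qed.

Let csqpos : {for z, continuous (fun z : 'rV[R]_(m + k) => sqpos (sqx z - e))}.
Proof.
apply: (continuous_comp (f := fun z : 'rV[R]_(m + k) => sqx z - e) (g := @sqpos R)).
  by apply: cont_add => //; exact: cont_cst.
apply: differentiable_continuous; apply/derivable1_diffP.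
by have [] := is_derive_sqpos (sqx z - e).
Qed.

Let cdcut : {for z, continuous (fun z : 'rV[R]_(m + k) => dcutoff e (sqx z))}.
Proof.
apply: cont_mul.
  apply: cont_mul; last exact: cont_cst.
  apply: cont_mul; first exact: cont_cst.
  apply: (continuous_comp (f := fun z : 'rV[R]_(m + k) => sqx z - e) (g := fun s : R => Num.max 0 s)).
    by apply: cont_add => //; exact: cont_cst.
  apply: (@continuous_max _ _ (fun _ => 0) id); [exact: cvg_cst|exact: cvg_id].
apply: cont_inv.
  by rewrite expf_neq0// lt0r_neq0// ltr_wpDl// sqpos_ge0.
apply: cont_exp; apply: cont_add => //; exact: cont_cst.
Qed.

Let ccoord j : {for z, continuous (fun z : 'rV[R]_(m + k) => z ord0 j)}.
Proof. exact: coord_continuous. Qed.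

Let cphi : {for z, continuous phi}.
Proof. exact: differentiable_continuous. Qed.

Let cdph j : {for z, continuous (fun z => derive phi z (delta_mx ord0 j))}.
Proof. exact: cdphi. Qed.

Lemma cont_dflux j : {for z, continuous (dflux j)}.
Proof.
rewrite /dflux /dfield /field /dfieldZ /dfieldX /dweight /dslope /dsqrho /dlogE /fieldZ /fieldX.
(* Recursion on the syntax of [dflux]; at the leaves, the inverses and real powers are continuous at
   [z] because of [p0]. *)
repeat match goal with
| |- {for _, continuous (fun z => @?f z + @?h z)} => apply: (@cont_add _ _ f h)
| |- {for _, continuous (fun z => @?f z * @?h z)} => apply: (@cont_mul _ _ f h)
| |- {for _, continuous (fun z => - @?f z)} => apply: (@cont_opp _ _ f)
| |- {for _, continuous (fun z => @?f z ^+ ?n)} => apply: (@cont_exp _ _ f n)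
| |- {for _, continuous (fun z => ?h)} => exact: cont_cst
| |- {for _, continuous (fun z => (sqx z)^-1)} => exact: cpV
| |- {for _, continuous (fun z => (gauge_pow _ z)^-1)} => exact: cEV
| |- {for _, continuous (fun z => weight _ _ _ z)} => exact: cw
| |- {for _, continuous (fun z => slope _ z)} => exact: csl
| |- {for _, continuous (fun z => sqrho _ z)} => exact: crho
| |- {for _, continuous (fun z => cutoff _ _)} => exact: ccut
| |- {for _, continuous (fun z => dcutoff _ _)} => exact: cdcut
| |- {for _, continuous (fun z => sqx z)} => exact: cp
| |- {for _, continuous (fun z => derive _ z _)} => exact: cdph
| |- {for _, continuous (fun z => phi z)} => exact: cphi
| |- {for _, continuous (fun z => fun_of_matrix z _ _)} => exact: ccoord
end.
Qed.

End at_point.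

Lemma continuous_dflux j : continuous (dflux j).
Proof.
move=> z; have [p0|] := ltrP 0 (sqx z); first exact: cont_dflux.
move=> pz; have z0 : sqx z = 0 by apply/eqP; rewrite eq_le pz sqx_ge0.
have d0 u : sqx u < e -> dflux j u = 0.
  by move=> ue; rewrite /dflux cutoff_eq0 ?dcutoff_eq0 ?ltW// !mul0r !addr0 !mul0r.
rewrite /continuous_at (d0 z) ?z0//.
have h : {near z, cst 0 =1 dflux j} by apply: filterS (near_sqx_lt z0) => u /d0.
exact: cvg_trans (near_eq_cvg h) (cvg_cst _).
Qed.

End flux.

(** * The Hardy inequality at a point, up to a divergence *)

Section pointwise.
Context (R : realType) (m k gamma : nat).
Implicit Types (z : 'rV[R]_(m + k)).
Let g : R := gamma.+1%:R.

Let g0 : 0 < g. Proof. by rewrite ltr0n. Qed.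
Let gn0 : g != 0. Proof. exact: lt0r_neq0. Qed.

Lemma sqrho_expn z : sqrho gamma z ^+ gamma.+1 = gauge_pow gamma z.
Proof.
have E0 := gauge_pow_ge0 gamma z.
by rewrite -powR_mulrn ?powR_ge0// /sqrho -powRrM mulVf// powRr1.
Qed.

Lemma sqx_le_sqrho z : sqx z <= sqrho gamma z.
Proof.
rewrite -(@ler_pXn2r _ gamma.+1)// ?nnegrE ?sqx_ge0 ?powR_ge0//.
by rewrite sqrho_expn lerDl mulr_ge0 ?sqr_ge0 ?sqy_ge0.
Qed.

(** This is |grad rho| <= 1, a consequence of |x| <= rho. *)
Lemma slope_sqrho_le1 z : 0 < sqx z -> slope gamma z * sqrho gamma z <= 1.
Proof.
move=> p0; have E0 := gauge_pow_gt0 gamma p0.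
rewrite /slope mulrAC ler_pdivrMr// mul1r -[leRHS]sqrho_expn exprSr.
apply: ler_wpM2r; first exact: powR_ge0.
by apply: lerXn2r (sqx_le_sqrho z); rewrite nnegrE ?sqx_ge0 ?powR_ge0.
Qed.

Lemma gradG2E (phi : 'rV[R]_(m + k) -> R) z :
  gradG2 gamma phi z = \sum_(i < m) derive phi z (delta_mx ord0 (lshift k i)) ^+ 2
   + sqx z ^+ gamma * \sum_(j < k) derive phi z (delta_mx ord0 (rshift m j)) ^+ 2.
Proof. by rewrite /gradG2 enorm_xpart exprM sqr_sqrtr ?sqx_ge0. Qed.

Lemma gradG2_ge0 (phi : 'rV[R]_(m + k) -> R) z : 0 <= gradG2 gamma phi z.
Proof.
rewrite gradG2E addr_ge0 ?mulr_ge0 ?exprn_ge0 ?sqx_ge0//;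
  by apply: sumr_ge0 => i _; exact: sqr_ge0.
Qed.

Lemma weight_ge0 (a b : R) z : 0 <= weight gamma a b z.
Proof. by rewrite mulr_ge0 ?powR_ge0. Qed.

Lemma slope_ge0 z : 0 <= slope gamma z.
Proof. by rewrite divr_ge0 ?exprn_ge0 ?sqx_ge0 ?gauge_pow_ge0. Qed.

Lemma sum_affine n (x d : 'I_n -> R) (A B C : R) :
  \sum_i (A * x i ^+ 2 + B + C * (x i * d i)) =
  A * (\sum_i x i ^+ 2) + n%:R * B + C * \sum_i x i * d i.
Proof.
by rewrite !big_split/= -!mulr_sumr sumr_const card_ord mulr_natl.
Qed.

Lemma isx_lshift i : isx R (lshift k i : 'I_(m + k)) = 1.
Proof. by rewrite /isx (unsplitK (inl i)). Qed.
Lemma isy_lshift i : isy R (lshift k i : 'I_(m + k)) = 0.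
Proof. by rewrite /isy (unsplitK (inl i)). Qed.
Lemma homdeg_lshift i : homdeg R gamma (lshift k i : 'I_(m + k)) = 1.
Proof. by rewrite /homdeg (unsplitK (inl i)). Qed.
Lemma isx_rshift i : isx R (rshift m i : 'I_(m + k)) = 0.
Proof. by rewrite /isx (unsplitK (inr i)). Qed.
Lemma isy_rshift i : isy R (rshift m i : 'I_(m + k)) = 1.
Proof. by rewrite /isy (unsplitK (inr i)). Qed.
Lemma homdeg_rshift i : homdeg R gamma (rshift m i : 'I_(m + k)) = g.
Proof. by rewrite /homdeg (unsplitK (inr i)). Qed.

Variables (a b c M e delta r2 : R) (phi : 'rV[R]_(m + k) -> R).
Let mu := delta / r2.
Hypotheses (e0 : 0 < e) (r20 : 0 < r2) (c0 : 0 < c) (M0 : 0 <= M).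
Hypothesis ma0 : 0 < m%:R + 2 * a.
Hypothesis degE :
  2 * a + 2 * gamma%:R + 2 * (b - 1) * g + m%:R + k%:R * g = 2 * c.
Hypothesis hM : `|2 * (b * g) - 2 * c| <= 2 * M.
Hypothesis deltaE : delta = (m%:R + 2 * a) / (2 * (M + 1) ^+ 2).

Lemma hardy_pointwise z : (phi z != 0 -> sqrho gamma z <= r2) ->
  cutoff e (sqx z) * (weight gamma a b z
    * (c ^+ 2 * slope gamma z + delta * (m%:R + 2 * a) / 2 / r2) * phi z ^+ 2) <=
  weight gamma a b z * gradG2 gamma phi z
  + \sum_j dflux gamma a b c mu M e phi j z.
Proof.
move=> hr.
have [p0|] := ltrP 0 (sqx z); last first.
  move=> pz; have z0 : sqx z = 0 by apply/eqP; rewrite eq_le pz sqx_ge0.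
  have S0 : \sum_j dflux gamma a b c mu M e phi j z = 0.
    rewrite big1// => j _.
    by rewrite /dflux cutoff_eq0 ?dcutoff_eq0 ?z0 ?(ltW e0)// !mul0r !addr0 !mul0r.
  rewrite S0 addr0 cutoff_eq0 ?z0 ?(ltW e0)// mul0r.
  by rewrite mulr_ge0 ?weight_ge0 ?gradG2_ge0.
have [phi0|phin0] := eqVneq (phi z) 0.
  have S0 : \sum_j dflux gamma a b c mu M e phi j z = 0.
    rewrite big1// => j _.
    by rewrite /dflux phi0 expr0n !mulr0 !mul0r !mulr0 addr0.
  rewrite S0 addr0 phi0 expr0n !mulr0.
  by rewrite mulr_ge0 ?weight_ge0 ?gradG2_ge0.
have {hr} Rr := hr phin0.
have M10 : 0 < (M + 1) ^+ 2 by rewrite exprn_gt0// ltr_wpDl.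
have d0 : 0 < delta by rewrite deltaE divr_gt0// mulr_gt0.
have mu0 : 0 < mu by rewrite divr_gt0.
have E0 := gauge_pow_gt0 gamma p0.
have pR := sqx_le_sqrho z; have TR := slope_sqrho_le1 p0.
have T0 : 0 < slope gamma z by rewrite divr_gt0// exprn_gt0.
have w0 : 0 < weight gamma a b z by rewrite mulr_gt0// powR_gt0.
have P0 : 0 < sqx z ^+ gamma by rewrite exprn_gt0.
have EE : gauge_pow gamma z = sqx z * sqx z ^+ gamma + g ^+ 2 * sqy z.
  by rewrite /gauge_pow exprS.
have gn1 : 1 + gamma%:R != 0 :> R by rewrite addrC natr1.
have gE : g = gamma%:R + 1 by rewrite /g -natr1.
have eta0 := cutoff_ge0 (sqx z) e0; have eta1 := cutoff_le1 (sqx z) e0.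
have deta0 := dcutoff_ge0 (sqx z) e0.
set eta := cutoff e (sqx z) in eta0 eta1 *.
set deta := dcutoff e (sqx z) in deta0 *.
set s := c + mu * M * sqrho gamma z.
set Z := fieldZ gamma a b c mu M z.
have ZE : Z = weight gamma a b z * slope gamma z * s by [].
set X := fieldX gamma a b mu z.
have XE : X = mu * weight gamma a b z by [].
have := divergence_identity (m := m%:R) (k := k%:R) (weight gamma a b z) (sqrho gamma z) mu M
  p0 P0 E0 g0 EE gE degE.
rewrite /= -/(slope gamma z) -/s -ZE -XE.
set Zp := _ + weight gamma a b z * slope gamma z * (mu * M * sqrho gamma z * _ * _).
set Xp := mu * weight gamma a b z * _.
set Zq := _ + weight gamma a b z * slope gamma z * (mu * M * sqrho gamma z * g * _).
move=> divE.
(* [fieldZ] depends on [z] through [sqx] and [sqy] only, and a coordinate x_i or y_j moves just one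
   of the two. *)
have dZp p' : dfieldZ gamma a b c mu M z p' 0 = Zp * p'.
  rewrite /dfieldZ /dweight /dslope /dsqrho /dlogE -/g -/s /Zp; field.
  by rewrite gn1 !lt0r_neq0.
have dXp p' : dfieldX gamma a b mu z p' 0 = Xp * p'.
  by rewrite /dfieldX /dweight /dlogE -/g /Xp; ring.
have dZq q' : dfieldZ gamma a b c mu M z 0 q' = Zq * q'.
  rewrite /dfieldZ /dweight /dslope /dsqrho /dlogE -/g -/s /Zq; field.
  by rewrite gn1 !lt0r_neq0.
rewrite big_split_ord/=.
pose dx i := derive phi z (delta_mx ord0 (lshift k i)).
pose dy i := derive phi z (delta_mx ord0 (rshift m i)).
pose x i := z ord0 (lshift k i); pose y i := z ord0 (rshift m i).
have -> : \sum_(i < m) dflux gamma a b c mu M e phi (lshift k i) z =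
    \sum_(i < m) (2 * (deta * (Z + X) + eta * (Zp + Xp)) * phi z ^+ 2 * x i ^+ 2
      + eta * (Z + X) * phi z ^+ 2 + 2 * eta * (Z + X) * phi z * (x i * dx i)).
  apply: eq_bigr => i _.
  rewrite /dflux /dfield /field isx_lshift isy_lshift homdeg_lshift.
  rewrite mulr0 mul0r dZp dXp -/eta -/deta -/Z -/X -/(x i) -/(dx i); ring.
have -> : \sum_(i < k) dflux gamma a b c mu M e phi (rshift m i) z =
    \sum_(i < k) (2 * (eta * (g * Zq)) * phi z ^+ 2 * y i ^+ 2
      + eta * (g * Z) * phi z ^+ 2 + 2 * eta * (g * Z) * phi z * (y i * dy i)).
  apply: eq_bigr => i _.
  rewrite /dflux /dfield /field isx_rshift isy_rshift homdeg_rshift.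
  rewrite mulr0 mul0r dZq -/eta -/deta -/Z -/X -/(y i) -/(dy i); ring.
have -> : gradG2 gamma phi z =
    \sum_i dx i ^+ 2 + sqx z ^+ gamma * \sum_i dy i ^+ 2 by exact: gradG2E.
rewrite !sum_affine.
rewrite -[\sum_(i < m) x i ^+ 2]/(sqx z) -[\sum_(i < k) y i ^+ 2]/(sqy z).
have cx := completed_square (phi z) (Z + X) w0 eta0 eta1 (sqx_ge0 z) (sum_square_ge0 x dx).
(* The y derivatives enter [gradG2] with the factor |x|^(2 gamma), hence the weight w P instead of
   w. *)
have cy := completed_square (phi z) (g * Z) (mulr_gt0 w0 P0) eta0 eta1 (sqy_ge0 z) (sum_square_ge0 y dy).
have en := energy_identity (g := g) s mu w0 P0 E0 g0 EE (erefl : slope gamma z = _).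
rewrite /= -ZE -XE in en.
have rb := remainder_bound (m := m%:R) ma0 r20 T0 p0 M0 TR pR Rr hM deltaE (erefl mu) (erefl s).
have s0 : 0 <= s.
  by rewrite addr_ge0 ?(ltW c0)// mulr_ge0 ?powR_ge0// mulr_ge0// ltW.
have Z0 : 0 <= Z by rewrite ZE mulr_ge0// mulr_ge0// ltW.
have X0 : 0 <= X by rewrite XE mulr_ge0// ltW.
(* Contribution of the derivative of the cutoff: the flux has nonnegative coefficients since c > 0
   and mu > 0, so it points away from {x = 0}. *)
have f0 : 0 <= 2 * (sqx z * deta * (Z + X)) * phi z ^+ 2.
  rewrite mulr_ge0 ?sqr_ge0// mulr_ge0// mulr_ge0 ?addr_ge0//.
  by rewrite mulr_ge0 ?sqx_ge0.
have key : eta * phi z ^+ 2 * (weight gamma a b z *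
    (c ^+ 2 * slope gamma z + delta * (m%:R + 2 * a) / 2 / r2)) <=
  eta * phi z ^+ 2 * (2 * sqx z * (Zp + Xp) + m%:R * (Z + X) + 2 * sqy z * (g * Zq) + k%:R * (g * Z)
    - ((Z + X) ^+ 2 * sqx z / weight gamma a b z
      + (g * Z) ^+ 2 * sqy z / (weight gamma a b z * sqx z ^+ gamma))).
  apply: ler_wpM2l; first by rewrite mulr_ge0 ?sqr_ge0.
  rewrite divE en -mulrBr; apply: ler_wpM2l; first exact: ltW.
  by apply: le_trans rb _; rewrite le_eqVlt; apply/orP; left; apply/eqP; ring.
(* [cx] and [cy] absorb the products of [phi] with its gradient, [key] compares the divergence of
   the field with its energy, and [f0] discards the cutoff term. *)
lra.
Qed.

End pointwise.

(** * The gauge, and test functions *)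

Section gauge.
Context (R : realType) (m k gamma : nat).
Implicit Types (z : 'rV[R]_(m + k)).
Let g : R := gamma.+1%:R.

Lemma rhoE z : rho gamma z = gauge_pow gamma z `^ (2 * g)^-1.
Proof.
by rewrite /rho enorm_xpart enorm_ypart exprM !sqr_sqrtr ?sqx_ge0 ?sqy_ge0.
Qed.

Lemma rho_sqr z : rho gamma z ^+ 2 = sqrho gamma z.
Proof.
rewrite rhoE -powR_mulrn ?powR_ge0// -powRrM /sqrho; congr powR.
rewrite /g; field.
by rewrite addrC natr1 pnatr_eq0.
Qed.

(** The classical |grad rho| = |x|^gamma / rho^gamma, squared; the x and y contributions add up
    through E = p P + (1+gamma)^2 q. *)
Lemma gradG2_rho z : 0 < sqx z ->
  gradG2 gamma (@rho R m k gamma) z = sqrho gamma z * slope gamma z.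
Proof.
move=> p0; have E0 := gauge_pow_gt0 gamma p0.
have gn1 : 1 + gamma%:R != 0 :> R by rewrite addrC natr1 pnatr_eq0.
have rE : @rho R m k gamma = fun z => gauge_pow gamma z `^ (2 * g)^-1.
  by apply/funext => u; exact: rhoE.
have dr j : derive (@rho R m k gamma) z (delta_mx ord0 j) =
    rho gamma z * (2 * g)^-1 * dlogE gamma z (2 * isx R j * z ord0 j) (2 * isy R j * z ord0 j).
  have := is_derive_fpowR (2 * g)^-1 E0
    (is_derive_gauge_pow gamma p0 (is_derive_sqx z j) (is_derive_sqy z j)).
  move=> d; rewrite rE (@derive_val _ _ _ _ _ _ _ d); field.
  by rewrite gn1 lt0r_neq0.
rewrite gradG2E.
have -> : \sum_(i < m) derive (@rho R m k gamma) z (delta_mx ord0 (lshift k i)) ^+ 2 =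
  (rho gamma z * (sqx z ^+ gamma / gauge_pow gamma z)) ^+ 2 * sqx z.
  rewrite /sqx mulr_sumr; apply: eq_bigr => i _; rewrite dr -/(sqx z).
  rewrite isx_lshift isy_lshift /dlogE; field.
  by rewrite gn1 lt0r_neq0.
have -> : \sum_(j < k) derive (@rho R m k gamma) z (delta_mx ord0 (rshift m j)) ^+ 2 =
  (rho gamma z * (g / gauge_pow gamma z)) ^+ 2 * sqy z.
  rewrite /sqy mulr_sumr; apply: eq_bigr => i _; rewrite dr.
  rewrite isx_rshift isy_rshift /dlogE /g; field.
  by rewrite gn1 lt0r_neq0.
rewrite !exprMn rho_sqr /slope.
have EE : gauge_pow gamma z = sqx z * sqx z ^+ gamma + g ^+ 2 * sqy z.
  by rewrite /gauge_pow exprS.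
have -> : sqy z = (gauge_pow gamma z - sqx z * sqx z ^+ gamma) / g ^+ 2.
  by rewrite EE /g; field; rewrite gn1.
rewrite /g; field.
by rewrite gn1 lt0r_neq0.
Qed.

Lemma powR_gradGnorm_rho z (s : R) : 0 < sqx z ->
  gradGnorm gamma (@rho R m k gamma) z `^ s = (sqrho gamma z * slope gamma z) `^ (s / 2).
Proof.
move=> p0; rewrite /gradGnorm gradG2_rho// -powR12_sqrt.
  by rewrite -powRrM; congr powR; rewrite mulrC.
by rewrite mulr_ge0 ?slope_ge0 ?powR_ge0.
Qed.

Lemma sqrho_slopeE z : 0 < sqx z ->
  sqrho gamma z * slope gamma z = sqx z `^ gamma%:R * gauge_pow gamma z `^ (g^-1 - 1).
Proof.
move=> p0; have E0 := gauge_pow_gt0 gamma p0.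
rewrite powR_mulrn ?sqx_ge0// powRB ?lt0r_neq0 ?implybT// powRr1 ?(ltW E0)//.
by rewrite /sqrho /slope; ring.
Qed.

(** By |grad rho| = (|x| / rho)^gamma the weight is |x|^(gamma t) rho^(alpha - gamma t); the
    exponents are those of |x|^2 and rho^(2(1+gamma)). *)
Lemma weightE z (alpha t : R) : 0 < sqx z ->
  rho gamma z `^ alpha * gradGnorm gamma (@rho R m k gamma) z `^ t =
  weight gamma (gamma%:R * t / 2) ((alpha - gamma%:R * t) / (2 * g)) z.
Proof.
move=> p0; have E0 := gauge_pow_gt0 gamma p0.
rewrite powR_gradGnorm_rho// sqrho_slopeE// powRM ?powR_ge0// rhoE -!powRrM.
rewrite mulrCA -powRD ?lt0r_neq0 ?implybT// /weight mulrA.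
congr (powR _ _ * powR _ _).
rewrite /g; field.
by rewrite addrC natr1 pnatr_eq0.
Qed.

Lemma weight_slopeE z (alpha t : R) : 0 < sqx z ->
  rho gamma z `^ alpha * gradGnorm gamma (@rho R m k gamma) z `^ (t + 2)
    / rho gamma z ^+ 2 =
  weight gamma (gamma%:R * t / 2) ((alpha - gamma%:R * t) / (2 * g)) z
    * slope gamma z.
Proof.
move=> p0; have E0 := gauge_pow_gt0 gamma p0.
have s0 : 0 < sqrho gamma z by rewrite powR_gt0.
have l0 : 0 < slope gamma z by rewrite divr_gt0 ?exprn_gt0.
rewrite -weightE// !powR_gradGnorm_rho// rho_sqr.
have -> : (t + 2) / 2 = t / 2 + 1 by field.
have u0 := mulr_gt0 s0 l0.
rewrite powRD ?(lt0r_neq0 u0) ?implybT// powRr1 ?(ltW u0)//.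
field.
exact: lt0r_neq0.
Qed.

End gauge.

Section measurability.
Context (R : realType) (m k gamma : nat).
Context d (S : measurableType d).

Lemma continuous_gauge_pow : continuous (@gauge_pow R m k gamma).
Proof.
apply: cont_all => z; apply: cont_add; first by apply: cont_exp; exact: continuous_sqx.
by apply: cont_mul; [exact: cont_cst|exact: continuous_sqy].
Qed.

Lemma jmeas_weight (a b : R) : jmeas (fun _ : S => @weight R m k gamma a b).
Proof.
apply: (jmeas_funM (f := fun _ z => sqx z `^ a) (g := fun _ z => gauge_pow gamma z `^ b)).
  apply: (jmeas_comp (g := fun x : R => x `^ a) (f := fun _ z => sqx z)) => //.
  by apply: jmeas_continuous; exact: continuous_sqx.
apply: (jmeas_comp (g := fun x : R => x `^ b) (f := fun _ z => gauge_pow gamma z)) => //.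
by apply: jmeas_continuous; exact: continuous_gauge_pow.
Qed.

Lemma jmeas_slope : jmeas (fun _ : S => @slope R m k gamma).
Proof.
(* As a real power, the inverse is a measurable function of its base, including at the origin where
   [gauge_pow] vanishes. *)
rewrite (_ : (fun _ => _) = fun _ z => sqx z ^+ gamma * gauge_pow gamma z `^ (-1)).
  apply: (jmeas_funM (f := fun _ z => sqx z ^+ gamma) (g := fun _ z => gauge_pow gamma z `^ (-1))).
    by apply: jmeas_continuous; apply: cont_all => z; apply: cont_exp; exact: continuous_sqx.
  apply: (jmeas_comp (g := fun x : R => x `^ (-1)) (f := fun _ z => gauge_pow gamma z)) => //.
  by apply: jmeas_continuous; exact: continuous_gauge_pow.
by apply/funext => s; apply/funext => z; rewrite powR_inv1 ?gauge_pow_ge0.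
Qed.

Lemma jmeas_sqx_gt0 : jmeas (fun (_ : S) (z : 'rV[R]_(m + k)) => (0 < sqx z)%R%:R : R).
Proof.
apply: (jmeas_comp (g := fun x : R => (0 < x)%R%:R : R) (f := fun _ z => sqx z)).
  rewrite (_ : (fun x => _) = (fun x : R => if 0 < x then 1 else 0)); last first.
    by apply/funext => x; case: (0 < x).
  by apply: measurable_fun_ifT => //; exact: measurable_fun_ltr.
by apply: jmeas_continuous; exact: continuous_sqx.
Qed.

Lemma continuous_gradG2 (phi : 'rV[R]_(m + k) -> R) :
  (forall v, continuous (fun z => derive phi z v)) ->
  continuous (gradG2 gamma phi).
Proof.
move=> cphi; rewrite (_ : gradG2 _ _ = fun z => \sum_(i < m) derive phi z (delta_mx ord0 (lshift k i)) ^+ 2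
   + sqx z ^+ gamma * \sum_(j < k) derive phi z (delta_mx ord0 (rshift m j)) ^+ 2); last first.
  by apply/funext => z; exact: gradG2E.
apply: cont_all => z; apply: cont_add.
  by apply: continuous_fsum => i; apply: cont_all => u; apply: cont_exp; exact: cphi.
apply: cont_mul; first by apply: cont_exp; exact: continuous_sqx.
by apply: continuous_fsum => i; apply: cont_all => u; apply: cont_exp; exact: cphi.
Qed.

End measurability.

Section test_function.
Context (R : realType) (n : nat) (U : set 'rV[R]_n) (phi : 'rV[R]_n -> R).
Hypothesis Uphi : Cc_infty U phi.

Lemma Cc_differentiable z : differentiable phi z.
Proof. by have [/(_ 1%N) [+ _] _ _] := Uphi; exact. Qed.

Lemma Cc_continuous_derive v : continuous (fun z => derive phi z v).
Proof. by have [/(_ 1%N) [_ +] _ _] := Uphi; exact. Qed.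

Lemma Cc_near0 z : ~ U z -> \forall u \near z, phi u = 0.
Proof.
have [_ _ sU] := Uphi => /(contra_not (@sU z)) nz.
apply: contrapT => h; apply: nz => B zB; apply: contrapT => hB; apply: h.
apply: filterS zB => u Bu; apply: contrapT => /eqP phiu.
by apply: hB; exists u.
Qed.

Lemma Cc_eq0 z : ~ U z -> phi z = 0.
Proof. by move/Cc_near0/nbhs_singleton. Qed.

Lemma Cc_derive_eq0 z v : ~ U z -> derive phi z v = 0.
Proof.
move=> Uz; apply: is_derive_near0 (Cc_near0 Uz).
by apply: derivableP; apply: diff_derivable; exact: Cc_differentiable.
Qed.

Lemma Cc_bounded : exists2 L : R, 0 < L & forall z, L <= `|z| -> phi z = 0.
Proof.
have [_ /compact_bounded[M [_ hM]] _] := Uphi.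
(* Every number above M bounds the support, |M| + 1 in particular; one unit more makes the bound
   strict. *)
exists (`|M| + 2) => [|z]; first by rewrite ltr_wpDl.
apply: contraTeq => phiz; rewrite -ltNge.
apply: (@le_lt_trans _ _ (`|M| + 1)); last by rewrite ltrD2l ltr1n.
apply: hM; last exact: subset_closure.
by rewrite (le_lt_trans (ler_norm _))// ltrDl.
Qed.

End test_function.

(** * Assembling the inequality *)

Section main.
Context (R : realType) (m' k gamma : nat) (alpha t : R).
Let m := m'.+1.
Let g : R := gamma.+1%:R.
Let a : R := gamma%:R * t / 2.
Let b : R := (alpha - gamma%:R * t) / (2 * g).
Let c : R := (m%:R + (1 + gamma%:R) * k%:R + alpha - 2) / 2.
(** The smallest value that [remainder_bound] admits. *)
Let M : R := `|2 * (b * g) - 2 * c| / 2.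
(** Maximizes delta (m + 2 a) - delta^2 (M + 1)^2, the gain minus the quadratic loss; the maximum is
    [kappa]. *)
Let delta : R := (m%:R + 2 * a) / (2 * (M + 1) ^+ 2).
Let kappa : R := delta * (m%:R + 2 * a) / 2.

Hypotheses (c0 : 0 < c) (ma0 : 0 < m%:R + 2 * a).

Let M0 : 0 <= M. Proof. by rewrite divr_ge0. Qed.

Let delta0 : 0 < delta.
Proof. by rewrite divr_gt0// mulr_gt0// exprn_gt0// ltr_wpDl. Qed.

Lemma kappa_gt0 : 0 < kappa.
Proof. by rewrite divr_gt0// mulr_gt0. Qed.

(** Under the dilations [weight] has degree alpha and [slope] degree -2, and the generator has
    divergence Q = m + (1+gamma) k. *)
Let degE : 2 * a + 2 * gamma%:R + 2 * (b - 1) * g + m%:R + k%:R * g = 2 * c.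
Proof.
rewrite /a /b /c /g -natr1; field.
by rewrite addrC natr1 pnatr_eq0.
Qed.

Variables (r : R) (phi : 'rV[R]_(m + k) -> R).
Hypotheses (r0 : 0 < r) (Hphi : Cc_infty (gball gamma r) phi).

Let cphi : continuous phi.
Proof. by move=> z; apply: differentiable_continuous; exact: (Cc_differentiable Hphi). Qed.

Let w (z : 'rV[R]_(m + k)) := weight gamma a b z.

(** The pointwise limit of the cutoffs as e tends to 0. *)
Let pos (z : 'rV[R]_(m + k)) : R := (0 < sqx z)%R%:R.

Let sqrho_le (z : 'rV[R]_(m + k)) : rho gamma z < r -> sqrho gamma z <= r ^+ 2.
Proof.
move=> rr; rewrite -rho_sqr; apply: lerXn2r; rewrite ?nnegrE ?(ltW r0) ?(ltW rr)//.
by rewrite rhoE powR_ge0.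
Qed.

Let F (z : 'rV[R]_(m + k)) :=
  w z * (c ^+ 2 * slope gamma z + kappa / r ^+ 2) * phi z ^+ 2.

Let F_ge0 z : 0 <= F z.
Proof.
rewrite mulr_ge0 ?sqr_ge0// mulr_ge0 ?weight_ge0// addr_ge0//.
  by rewrite mulr_ge0 ?sqr_ge0 ?slope_ge0.
by rewrite divr_ge0 ?sqr_ge0// ltW// kappa_gt0.
Qed.

Let mphi2 : jmeas (fun _ : unit => fun z => phi z ^+ 2).
Proof. by apply: jmeas_continuous; apply: cont_all => z; apply: cont_exp; exact: cphi. Qed.

Let mcst (x : R) : jmeas (fun (_ : unit) (_ : 'rV[R]_(m + k)) => x).
Proof. by apply: jmeas_continuous; apply: cont_all => z; exact: cont_cst. Qed.

Let mF : jmeas (fun _ : unit => F).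
Proof.
apply: (jmeas_funM (f := fun _ z => w z * (c ^+ 2 * slope gamma z + kappa / r ^+ 2))
  (g := fun _ z => phi z ^+ 2)) mphi2.
apply: (jmeas_funM (f := fun _ z => w z)
  (g := fun _ z => c ^+ 2 * slope gamma z + kappa / r ^+ 2)); first exact: jmeas_weight.
apply: (jmeas_funD (f := fun _ z => c ^+ 2 * slope gamma z)
  (g := fun _ z => kappa / r ^+ 2)); last exact: mcst.
by apply: (jmeas_funM (f := fun _ z => c ^+ 2) (g := fun _ z => slope gamma z));
  [exact: mcst|exact: jmeas_slope].
Qed.

Let D (z : 'rV[R]_(m + k)) := w z * gradG2 gamma phi z.

Let mD : jmeas (fun _ : unit => D).
Proof.
apply: (jmeas_funM (f := fun _ z => w z) (g := fun _ z => gradG2 gamma phi z)).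
  exact: jmeas_weight.
by apply: jmeas_continuous; apply: continuous_gradG2; exact: (Cc_continuous_derive Hphi).
Qed.

Let D_ge0 z : 0 <= D z. Proof. by rewrite mulr_ge0 ?weight_ge0 ?gradG2_ge0. Qed.

Let mcut (e : R) : 0 < e ->
  jmeas (fun (_ : unit) (z : 'rV[R]_(m + k)) => cutoff e (sqx z)).
Proof.
move=> e0; apply: jmeas_continuous; apply: cont_all => z.
apply: (continuous_comp (g := cutoff e)); first exact: continuous_sqx.
apply: differentiable_continuous; apply/derivable1_diffP.
by have [] := is_derive_cutoff (sqx z) e0.
Qed.

Let cutoff_bound (e : R) : 0 < e ->
  (lebint (fun z => (cutoff e (sqx z) * F z)%:E) <= lebint (fun z => (D z)%:E))%E.
Proof.
move=> e0; have [L L0 hL] := Cc_bounded Hphi.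
pose mu := delta / r ^+ 2.
apply: (@lebint_divergence_le _ _ _ _ (flux gamma a b c mu M e phi)
  (dflux gamma a b c mu M e phi) L) => //.
- by move=> z; rewrite mulr_ge0 ?cutoff_ge0.
- apply: (jmeas_funM (f := fun _ z => cutoff e (sqx z)) (g := fun _ => F)) => //.
  exact: mcut.
- move=> j z; apply: is_derive_flux => // u; exact: (Cc_differentiable Hphi).
- move=> j; apply: continuous_dflux => //.
  + by move=> u; exact: (Cc_differentiable Hphi).
  + exact: (Cc_continuous_derive Hphi).
- by move=> j z Lz; rewrite /flux hL// expr0n mulr0.
move=> z; have hM : `|2 * (b * g) - 2 * c| <= 2 * M.
  by rewrite [2 * M]mulrC /M mulfVK ?pnatr_eq0.
apply: (hardy_pointwise e0 (exprn_gt0 2 r0) c0 M0 ma0 degE hM (erefl delta)).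
move=> phin0; apply: sqrho_le; apply: contrapT => nr.
by move/eqP: phin0; apply; exact: (Cc_eq0 Hphi).
Qed.

Let F_bound :
  (lebint (fun z => (pos z * F z)%:E) <= lebint (fun z => (D z)%:E))%E.
Proof.
pose f N (z : 'rV[R]_(m + k)) : \bar R := (cutoff (N.+1%:R^-1) (sqx z) * F z)%:E.
have cv : lebint (f N) @[N --> \oo] --> lebint (fun z => (pos z * F z)%:E).
  apply: (@cvg_monotone_lebint _ _ _ unit (fun N _ => f N)
     (fun _ z => (pos z * F z)%:E) tt).
  - by move=> N _ z; rewrite lee_fin mulr_ge0 ?cutoff_ge0 ?invr_gt0.
  - move=> N; apply: (jmeas_EFin (f := fun _ z => cutoff (N.+1%:R^-1) (sqx z) * F z)).
    apply: (jmeas_funM (f := fun _ z => cutoff (N.+1%:R^-1) (sqx z)) (g := fun _ => F)) => //.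
    by apply: mcut; rewrite invr_gt0.
  - move=> _ z N N' NN'; rewrite lee_fin; apply: ler_wpM2r => //.
    apply: cutoff_anti; first by rewrite invr_gt0.
    by rewrite lef_pV2 ?posrE// ler_nat.
  - move=> _ z; have [p0|p0] := ltrP 0 (sqx z).
      apply: cvg_EFin; first exact: nearW.
      by rewrite /pos p0; apply: cvgMl; exact: cvg_cutoff.
    have z0 : sqx z = 0 by apply/eqP; rewrite eq_le p0 sqx_ge0.
    rewrite /pos z0 ltxx mul0r (_ : f ^~ z = cst 0%:E); first exact: cvg_cst.
    by apply/funext => N; rewrite /f z0 cutoff_eq0 ?mul0r// invr_ge0.
by apply: (cvge_le _ cv); apply: nearW => N; exact: cutoff_bound.
Qed.

(** As m is a successor, the first coordinate of [lebint] is an x coordinate, so {x = 0} lies in the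
    hyperplane that [eq_lebint_head] ignores. *)
Let sqx_gt0 (z : 'rV[R]_(m' + k).+1) :
  z ord0 ord0 != 0 -> 0 < sqx (z : 'rV[R]_(m + k)).
Proof.
move=> z0; rewrite /sqx big_ord_recl.
rewrite (_ : lshift k ord0 = ord0); last exact: val_inj.
by rewrite ltr_wpDr ?sumr_ge0// => [i _|]; rewrite ?sqr_ge0// exprn_even_gt0.
Qed.

Let ballP (z : 'rV[R]_(m + k)) : ~~ (rho gamma z < r) -> ~ gball gamma r z.
Proof. by move=> /negP. Qed.

(** [A0], [B0] and [D0] are the integrands of the theorem; [A1], [B1] and [D] are jointly measurable
    versions that agree with them off {x = 0}. The test for the ball disappears because [phi] and
    its derivatives vanish outside. *)
Let A0 (z : 'rV[R]_(m + k)) : R :=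
  if rho gamma z < r then
    powR (rho gamma z) alpha
    * powR (gradGnorm gamma (@rho R m k gamma) z) (t + 2)
    / rho gamma z ^+ 2 * phi z ^+ 2
  else 0.

Let B0 (z : 'rV[R]_(m + k)) : R :=
  if rho gamma z < r then
    powR (rho gamma z) alpha
    * powR (gradGnorm gamma (@rho R m k gamma) z) t * phi z ^+ 2
  else 0.

Let D0 (z : 'rV[R]_(m + k)) : R :=
  if rho gamma z < r then
    powR (rho gamma z) alpha
    * powR (gradGnorm gamma (@rho R m k gamma) z) t * gradG2 gamma phi z
  else 0.

Let A1 (z : 'rV[R]_(m + k)) : R := pos z * (w z * slope gamma z * phi z ^+ 2).
Let B1 (z : 'rV[R]_(m + k)) : R := pos z * (w z * phi z ^+ 2).

Let A1_ge0 z : 0 <= A1 z.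
Proof. by rewrite mulr_ge0// mulr_ge0 ?sqr_ge0// mulr_ge0 ?weight_ge0 ?slope_ge0. Qed.

Let B1_ge0 z : 0 <= B1 z.
Proof. by rewrite mulr_ge0// mulr_ge0 ?sqr_ge0// weight_ge0. Qed.

Let mA1 : jmeas (fun _ : unit => A1).
Proof.
apply: (jmeas_funM (f := fun _ => pos)
  (g := fun _ z => w z * slope gamma z * phi z ^+ 2)); first exact: jmeas_sqx_gt0.
apply: (jmeas_funM (f := fun _ z => w z * slope gamma z)
  (g := fun _ z => phi z ^+ 2)) mphi2.
by apply: (jmeas_funM (f := fun _ z => w z) (g := fun _ z => slope gamma z));
  [exact: jmeas_weight|exact: jmeas_slope].
Qed.

Let mB1 : jmeas (fun _ : unit => B1).
Proof.
apply: (jmeas_funM (f := fun _ => pos)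
  (g := fun _ z => w z * phi z ^+ 2)); first exact: jmeas_sqx_gt0.
apply: (jmeas_funM (f := fun _ z => w z) (g := fun _ z => phi z ^+ 2)) mphi2.
exact: jmeas_weight.
Qed.

Let A0E : lebint (fun z => (A0 z)%:E) = lebint (fun z => (A1 z)%:E).
Proof.
apply: (@eq_lebint_head R (m' + k) (fun z => (A0 z)%:E) (fun z => (A1 z)%:E)).
- move=> z /sqx_gt0 p0; congr EFin; rewrite /A0 /A1 /pos p0 mul1r.
  case: ifPn => [_|/ballP zr]; last by rewrite (Cc_eq0 Hphi zr) expr0n mulr0.
  by rewrite weight_slopeE.
- by move=> z; rewrite lee_fin.
- exact: (jmeas_EFin mA1).
Qed.

Let B0E : lebint (fun z => (B0 z)%:E) = lebint (fun z => (B1 z)%:E).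
Proof.
apply: (@eq_lebint_head R (m' + k) (fun z => (B0 z)%:E) (fun z => (B1 z)%:E)).
- move=> z /sqx_gt0 p0; congr EFin; rewrite /B0 /B1 /pos p0 mul1r.
  case: ifPn => [_|/ballP zr]; last by rewrite (Cc_eq0 Hphi zr) expr0n mulr0.
  by rewrite weightE.
- by move=> z; rewrite lee_fin.
- exact: (jmeas_EFin mB1).
Qed.

Let D0E : lebint (fun z => (D0 z)%:E) = lebint (fun z => (D z)%:E).
Proof.
apply: (@eq_lebint_head R (m' + k) (fun z => (D0 z)%:E) (fun z => (D z)%:E)).
- move=> z /sqx_gt0 p0; congr EFin; rewrite /D0 /D.
  case: ifPn => [_|/ballP zr]; first by rewrite weightE.
  rewrite gradG2E !big1 ?mulr0 ?addr0 ?mulr0// => i _;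
    by rewrite (Cc_derive_eq0 Hphi _ zr) expr0n.
- by move=> z; rewrite lee_fin.
- exact: (jmeas_EFin mD).
Qed.

Lemma hardy_remainder :
  ((c ^+ 2)%:E * lebint (fun z => (A0 z)%:E)
   + (kappa / r ^+ 2)%:E * lebint (fun z => (B0 z)%:E)
   <= lebint (fun z => (D0 z)%:E))%E.
Proof.
have k0 : 0 <= kappa / r ^+ 2 by rewrite divr_ge0 ?sqr_ge0// ltW// kappa_gt0.
rewrite A0E B0E D0E; apply: le_trans F_bound.
have A1_ge0E (_ : unit) z : (0 <= (A1 z)%:E)%E by rewrite lee_fin.
have B1_ge0E (_ : unit) z : (0 <= (B1 z)%:E)%E by rewrite lee_fin.
rewrite -(lebintZl tt A1_ge0E (jmeas_EFin mA1) (sqr_ge0 c)).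
rewrite -(lebintZl tt B1_ge0E (jmeas_EFin mB1) k0).
rewrite -(lebintD tt (f := fun _ z => ((c ^+ 2)%:E * (A1 z)%:E)%E)
  (g := fun _ z => ((kappa / r ^+ 2)%:E * (B1 z)%:E)%E)).
- rewrite le_eqVlt; apply/orP; left; apply/eqP; congr lebint.
  by apply/funext => z; rewrite -!EFinM -EFinD; congr EFin; rewrite /A1 /B1 /F; ring.
- by move=> _ z; rewrite lee_fin mulr_ge0 ?sqr_ge0.
- by move=> _ z; rewrite lee_fin mulr_ge0.
- apply: (jmeas_EFin (f := fun _ z => c ^+ 2 * A1 z)).
  by apply: (jmeas_funM (f := fun _ _ => c ^+ 2) (g := fun _ => A1)); first exact: mcst.
- apply: (jmeas_EFin (f := fun _ z => kappa / r ^+ 2 * B1 z)).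
  by apply: (jmeas_funM (f := fun _ _ => kappa / r ^+ 2) (g := fun _ => B1)); first exact: mcst.
Qed.

End main.

Theorem theorem3p1 (R : realType) (m k gamma : nat) (alpha t : R) :
  (0 < m)%N -> (0 < k)%N ->
  (0 < gamma)%N -> ~~ odd gamma ->
  - (m%:R / gamma%:R) < t -> t < m%:R / gamma%:R ->
  0 < m%:R + (1 + gamma%:R) * k%:R + alpha - 2 ->
  exists C : R, 0 < C /\
    forall (r : R) (phi : 'rV[R]_(m + k) -> R),
      0 < r -> Cc_infty (gball gamma r) phi ->
      ((((m%:R + (1 + gamma%:R) * k%:R + alpha - 2) / 2) ^+ 2)%:E *
        lebint (fun z => (if rho gamma z < r then
                  powR (rho gamma z) alpha
                  * powR (gradGnorm gamma (@rho R m k gamma) z) (t + 2)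
                  / rho gamma z ^+ 2 * phi z ^+ 2
                 else 0)%:E)
      + ((C ^+ 2 * r ^+ 2)^-1)%:E *
        lebint (fun z => (if rho gamma z < r then
                  powR (rho gamma z) alpha
                  * powR (gradGnorm gamma (@rho R m k gamma) z) t
                  * phi z ^+ 2
                 else 0)%:E)
      <= lebint (fun z => (if rho gamma z < r then
                  powR (rho gamma z) alpha
                  * powR (gradGnorm gamma (@rho R m k gamma) z) t
                  * gradG2 gamma phi z
                 else 0)%:E))%E.
Proof.
case: m => [//|m'] _ _ gamma0 _ tl _ Q0.
have c0 := divr_gt0 Q0 (ltr0n R 2 : 0 < 2 :> R).
(* This is m + gamma t > 0, the lower bound on t. *)
have ma0 : 0 < m'.+1%:R + 2 * (gamma%:R * t / 2) :> R.
  have g0 : 0 < gamma%:R :> R by rewrite ltr0n.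
  rewrite [2 * _]mulrC mulfVK ?pnatr_eq0// -(ltrBlDl) sub0r.
  by move: tl; rewrite -mulNr ltr_pdivrMr// mulrC.
have kap0 := @kappa_gt0 R m' k gamma alpha t ma0.
set kap := (X in 0 < X) in kap0.
(* Chosen so that 1 / C^2 = [kap], which depends only on m, k, gamma, alpha and t. *)
exists (Num.sqrt kap)^-1; split; first by rewrite invr_gt0 sqrtr_gt0.
move=> r phi r0 Hphi.
have -> : ((Num.sqrt kap)^-1 ^+ 2 * r ^+ 2)^-1 = kap / r ^+ 2.
  by rewrite invfM exprVn invrK sqr_sqrtr ?ltW.
exact: (hardy_remainder c0 ma0 r0 Hphi).
Qed.
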